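(* Let $A$ be a regular ring containing a field $k$ with $1/2\in k$, and let $\dim A=d$. Let $n\ge 2$ be an integer with $2n\ge d+2$. Then there is a structure of an abelian group on $\pi_0(\mathcal{LO}(A,n))=\pi_0(Q_{2n})(A)$, whose addition is determined as follows: if $x=\zeta(K,\omega_K)$ and $y=\zeta(I,\omega_I)$ in $\pi_0(Q_{2n})(A)$, where $(K,\omega_K),(I,\omega_I)\in\mathcal{LO}(A,n)$ satisfy $\operatorname{height}(K)\ge n$ and $K+I=A$, then $$x+y=\zeta(KI,\ \omega_K\star\omega_I)\in\pi_0(Q_{2n})(A),$$ where $\omega_K\star\omega_I:A^n\twoheadrightarrow \frac{KI}{(KI)^2}$ is the unique surjective map determined by $\omega_K$ and $\omega_I$.
   Context: All rings are commutative and noetherian. The unit ideal has height $\infty$. $\mathcal{LO}(A,n)$ is the set of pairs $(I,\omega)$ with $I$ an ideal of $A$ and $\omega:A^n\twoheadrightarrow I/I^2$ a surjective $A$-homomorphism. Substituting $T=0,1$ gives two maps $\mathcal{LO}(A[T],n)\to\mathcal{LO}(A,n)$ (an ideal is sent to its image in $A$ and $\omega$ to the induced surjection), and $\pi_0(\mathcal{LO}(A,n))$ is the quotient of $\mathcal{LO}(A,n)$ by the equivalence relation generated by identifying the $T=0$ and $T=1$ specializations of each element of $\mathcal{LO}(A[T],n)$. $Q_{2n}(A)=\{(s;f_1,\ldots,f_n;g_1,\ldots,g_n)\in A^{2n+1}:\sum_{i=1}^n f_ig_i+s(s-1)=0\}$, and $\pi_0(Q_{2n})(A)$ is the quotient of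 $Q_{2n}(A)$ by the equivalence relation generated by $H(0)\sim H(1)$ for $H(T)\in Q_{2n}(A[T])$. The map $\zeta:\mathcal{LO}(A,n)\to\pi_0(Q_{2n})(A)$: given $(I,\omega)$, choose $f_i\in I$ with $\omega(e_i)=f_i+I^2$ ($e_i$ the standard basis); then there are $s\in I$ and $g_i\in A$ with $I=(f_1,\dots,f_n,s)$ and $\sum f_ig_i+s(s-1)=0$, and $\zeta(I,\omega)$ is the class of $(s;f_1,\ldots,f_n;g_1,\ldots,g_n)$, which is independent of choices. The map $\zeta$ induces a bijection $\pi_0(\mathcal{LO}(A,n))\to\pi_0(Q_{2n})(A)$, through which the two sets are identified. If $I_1+I_2=A$ and $\omega_i:A^n\twoheadrightarrow I_i/I_i^2$ ($i=1,2$) are surjective, $\omega_1\star\omega_2:A^n\twoheadrightarrow I_1I_2/(I_1I_2)^2$ is the unique surjection inducing $\omega_1$ and $\omega_2$, via $I_1I_2/(I_1I_2)^2\cong I_1/I_1^2\oplus I_2/I_2^2$. *)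

(* Defs.v *)
From HB Require Import structures.
From Stdlib Require Import Relations.
From mathcomp Require Import all_boot all_order all_algebra.
From mathcomp Require Import boolp classical_sets.
From mathcomp Require Import ring.

Set Implicit Arguments.
Unset Strict Implicit.
Unset Printing Implicit Defensive.

Import GRing.Theory.
Local Open Scope ring_scope.
Local Open Scope classical_set_scope.
Local Open Scope quotient_scope.

(* Lets [I x] be written for [x] in [I] when [I] is a bundled ideal. *)
Identity Coercion set_to_pred : set >-> Funclass.

(* The unit ideal is allowed, unlike in [ring_quotient]. *)
Definition is_ideal (A : comNzRingType) (I : set A) : Prop :=
  [/\ I 0, forall x y, I x -> I y -> I (x + y) & forall a x, I x -> I (a * x)].

Record ideal (A : comNzRingType) := Ideal {
  ideal_set :> set A;
  ideal_setP : is_ideal ideal_set }.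

Section Ideals.
Context (A : comNzRingType).
Implicit Types (I J : ideal A) (S : set A) (a x y : A).

Lemma ideal_eq I J : ideal_set I = ideal_set J -> I = J.
Proof.
case: I J => [I hI] [J hJ] /= e; rewrite -e in hJ *; congr Ideal.
exact: Prop_irrelevance.
Qed.

Lemma ideal0 I : I 0. Proof. by case: (ideal_setP I). Qed.
Lemma idealD I x y : I x -> I y -> I (x + y).
Proof. by case: (ideal_setP I) => _ h _; exact: h. Qed.
Lemma idealMl I a x : I x -> I (a * x).
Proof. by case: (ideal_setP I) => _ _ h; exact: h. Qed.
Lemma idealMr I a x : I x -> I (x * a).
Proof. by rewrite mulrC; exact: idealMl. Qed.
Lemma idealN I x : I x -> I (- x).
Proof. by rewrite -mulN1r; exact: idealMl. Qed.
Lemma idealB I x y : I x -> I y -> I (x - y).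
Proof. by move=> hx /idealN; exact: idealD. Qed.
Lemma ideal_sum I n (F : 'I_n -> A) : (forall i, I (F i)) -> I (\sum_i F i).
Proof.
move=> h; elim/big_ind: _ => //; [exact: ideal0|by move=> x y; exact: idealD].
Qed.

Lemma ideal_span_subproof S : is_ideal (smallest (@is_ideal A) S).
Proof.
split=> [J [[h _ _] _] //|x y hx hy J hJ|a x hx J hJ].
  by have [_ hD _] := hJ.1; apply: hD; [exact: hx|exact: hy].
by have [_ _ hM] := hJ.1; apply: hM; exact: hx.
Qed.

Definition ideal_span S : ideal A := Ideal (ideal_span_subproof S).

Lemma ideal_span_sub S I : S `<=` I -> ideal_span S `<=` I.
Proof. by apply: smallest_sub; exact: ideal_setP. Qed.

Lemma sub_ideal_span S : S `<=` ideal_span S.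
Proof. exact: sub_gen_smallest. Qed.

Definition ideal_mul I J : ideal A := ideal_span [set x * y | x in I & y in J].

Lemma ideal_mul_in I J x y : I x -> J y -> ideal_mul I J (x * y).
Proof. by move=> hx hy; apply: sub_ideal_span; exists x => //; exists y. Qed.

Lemma ideal_mul_ind I J (K : ideal A) :
  (forall x y, I x -> J y -> K (x * y)) -> ideal_mul I J `<=` K.
Proof. by move=> h; apply: ideal_span_sub => _ [x hx [y hy <-]]; exact: h. Qed.

Definition comaximal I J : Prop := [set x + y | x in I & y in J] = [set: A].

End Ideals.

Definition noetherian (A : comNzRingType) : Prop :=
  forall I : ideal A, exists s : seq A, I = ideal_span [set` s].

Definition is_prime (A : comNzRingType) (P : ideal A) : Prop :=
  ~ P 1 /\ forall x y, P (x * y) -> P x \/ P y.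

Definition is_maximal (A : comNzRingType) (M : ideal A) : Prop :=
  ~ M 1 /\ forall J : ideal A, M `<=` J -> ~ J 1 -> J = M.

(* The length counts the strict inclusions, hence [m.+1] primes. *)
Definition prime_chain (A : comNzRingType) (m : nat) (P : 'I_m.+1 -> ideal A) :
    Prop :=
  (forall i, is_prime (P i)) /\ (forall i j : 'I_m.+1, (i < j)%N -> P i `<` P j).

Definition krull_dim (A : comNzRingType) (d : nat) : Prop :=
  (exists P : 'I_d.+1 -> ideal A, prime_chain P) /\
  (forall m (P : 'I_m.+1 -> ideal A), prime_chain P -> (m <= d)%N).

Definition prime_height_ge (A : comNzRingType) (P : ideal A) (n : nat) : Prop :=
  exists C : 'I_n.+1 -> ideal A, prime_chain C /\ C ord_max = P.

(* The height of [I] is the infimum of the heights of the primes containing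
   [I]; the infimum of the empty family, for the unit ideal, is infinite. *)
Definition height_ge (A : comNzRingType) (I : ideal A) (n : nat) : Prop :=
  forall P : ideal A, is_prime P -> I `<=` P -> prime_height_ge P n.

Section Localization.
Context (A : comNzRingType) (P : ideal A) (primeP : is_prime P).

Definition denom := {s : A | `[< ~ P s >]}.

Definition den (s : denom) : A := \val s.

Lemma denomP (s : denom) : ~ P (den s).
Proof. by case: s => s hs; exact/asboolP. Qed.

Definition to_denom (s : A) (hs : ~ P s) : denom :=
  exist (fun s => `[< ~ P s >]) s (asboolT hs).

Lemma denomM_subproof (s t : denom) : ~ P (den s * den t).
Proof. by move=> /primeP.2[]; exact: denomP. Qed.

Definition denom1 : denom := to_denom primeP.1.
Definition denomM (s t : denom) : denom := to_denom (@denomM_subproof s t).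

Lemma den1 : den denom1 = 1. Proof. by []. Qed.
Lemma denM s t : den (denomM s t) = den s * den t. Proof. by []. Qed.

Definition loc_rel (x y : A * denom) : bool :=
  `[< exists u : denom, den u * (x.1 * den y.2 - y.1 * den x.2) = 0 >].

Lemma loc_rel_refl : reflexive loc_rel.
Proof. by move=> x; apply/asboolP; exists denom1; rewrite subrr mulr0. Qed.

Lemma loc_rel_sym : symmetric loc_rel.
Proof.
move=> x y; apply/asboolP/asboolP => -[u hu]; exists u.
  by rewrite -opprB mulrN hu oppr0.
by rewrite -opprB mulrN hu oppr0.
Qed.

Lemma loc_rel_trans : transitive loc_rel.
Proof.
move=> [b t] [a s] [c r] /asboolP[u /= hu] /asboolP[v /= hv].
apply/asboolP; exists (denomM (denomM u v) t); rewrite !denM /=.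
transitivity (den v * den r * (den u * (a * den t - b * den s)) +
              den u * den s * (den v * (b * den r - c * den t))).
  by ring.
by rewrite hu hv !mulr0 addr0.
Qed.

Canonical loc_equiv := EquivRel loc_rel loc_rel_refl loc_rel_sym loc_rel_trans.

Definition localization := {eq_quot loc_rel}.
HB.instance Definition _ := Choice.on localization.
HB.instance Definition _ := EqQuotient.on localization.

Definition frac (a : A) (s : denom) : localization := \pi_localization (a, s).

Lemma frac_eq a b s t (u : denom) :
  den u * (a * den t - b * den s) = 0 -> frac a s = frac b t.
Proof. by move=> h; apply/eqmodP/asboolP; exists u. Qed.

Lemma frac_eqP a b s t : frac a s = frac b t ->
  exists u : denom, den u * (a * den t - b * den s) = 0.
Proof. by move=> /eqmodP/asboolP. Qed.

Lemma fracP (x : localization) : exists a s, x = frac a s.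
Proof. by exists (repr x).1, (repr x).2; rewrite /frac -surjective_pairing reprK. Qed.

Definition loc_add (x y : localization) : localization :=
  let: (a, s) := repr x in let: (b, t) := repr y in
  frac (a * den t + b * den s) (denomM s t).
Definition loc_opp (x : localization) : localization :=
  let: (a, s) := repr x in frac (- a) s.
Definition loc_mul (x y : localization) : localization :=
  let: (a, s) := repr x in let: (b, t) := repr y in frac (a * b) (denomM s t).

Lemma loc_addE a s b t :
  loc_add (frac a s) (frac b t) = frac (a * den t + b * den s) (denomM s t).
Proof.
rewrite /loc_add.
case ex : (repr (frac a s)) => [a' s']; case ey : (repr (frac b t)) => [b' t'].
have /frac_eqP[u hu] : frac a' s' = frac a s by rewrite /frac -ex reprK.
have /frac_eqP[v hv] : frac b' t' = frac b t by rewrite /frac -ey reprK.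
apply: (@frac_eq _ _ _ _ (denomM u v)); rewrite !denM.
transitivity (den v * den t * den t' * (den u * (a' * den s - a * den s')) +
   den u * den s * den s' * (den v * (b' * den t - b * den t'))).
  by ring.
by rewrite hu hv !mulr0 addr0.
Qed.

Lemma loc_oppE a s : loc_opp (frac a s) = frac (- a) s.
Proof.
rewrite /loc_opp; case ex : (repr (frac a s)) => [a' s'].
have /frac_eqP[u hu] : frac a' s' = frac a s by rewrite /frac -ex reprK.
apply: (@frac_eq _ _ _ _ u); rewrite !mulNr -opprD mulrN.
by rewrite hu oppr0.
Qed.

Lemma loc_mulE a s b t :
  loc_mul (frac a s) (frac b t) = frac (a * b) (denomM s t).
Proof.
rewrite /loc_mul.
case ex : (repr (frac a s)) => [a' s']; case ey : (repr (frac b t)) => [b' t'].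
have /frac_eqP[u hu] : frac a' s' = frac a s by rewrite /frac -ex reprK.
have /frac_eqP[v hv] : frac b' t' = frac b t by rewrite /frac -ey reprK.
apply: (@frac_eq _ _ _ _ (denomM u v)); rewrite !denM.
transitivity (den v * den t * b' * (den u * (a' * den s - a * den s')) +
   den u * den s' * a * (den v * (b' * den t - b * den t'))).
  by ring.
by rewrite hu hv !mulr0 addr0.
Qed.

Lemma frac_eq1 a b s t :
  a * den t - b * den s = 0 -> frac a s = frac b t.
Proof. by move=> h; apply: (@frac_eq _ _ _ _ denom1); rewrite h mulr0. Qed.

Lemma loc_addA : associative loc_add.
Proof.
move=> x y z; case: (fracP x) (fracP y) (fracP z) => [a [s ->]] [b [t ->]] [c [r ->]].
by rewrite !loc_addE; apply: frac_eq1; rewrite ?(denM, den1); ring.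
Qed.

Lemma loc_addC : commutative loc_add.
Proof.
move=> x y; case: (fracP x) (fracP y) => [a [s ->]] [b [t ->]].
by rewrite !loc_addE; apply: frac_eq1; rewrite ?(denM, den1); ring.
Qed.

Lemma loc_add0 : left_id (frac 0 denom1) loc_add.
Proof.
move=> x; case: (fracP x) => [a [s ->]].
by rewrite !loc_addE; apply: frac_eq1; rewrite ?(denM, den1); ring.
Qed.

Lemma loc_addN : left_inverse (frac 0 denom1) loc_opp loc_add.
Proof.
move=> x; case: (fracP x) => [a [s ->]].
by rewrite loc_oppE !loc_addE; apply: frac_eq1; rewrite ?(denM, den1); ring.
Qed.

HB.instance Definition _ :=
  GRing.isZmodule.Build localization loc_addA loc_addC loc_add0 loc_addN.

Lemma loc_mulA : associative loc_mul.
Proof.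
move=> x y z; case: (fracP x) (fracP y) (fracP z) => [a [s ->]] [b [t ->]] [c [r ->]].
by rewrite !loc_mulE; apply: frac_eq1; rewrite ?(denM, den1); ring.
Qed.

Lemma loc_mulC : commutative loc_mul.
Proof.
move=> x y; case: (fracP x) (fracP y) => [a [s ->]] [b [t ->]].
by rewrite !loc_mulE; apply: frac_eq1; rewrite ?(denM, den1); ring.
Qed.

Lemma loc_mul1 : left_id (frac 1 denom1) loc_mul.
Proof.
move=> x; case: (fracP x) => [a [s ->]].
by rewrite !loc_mulE; apply: frac_eq1; rewrite ?(denM, den1); ring.
Qed.

Lemma loc_mulD : left_distributive loc_mul loc_add.
Proof.
move=> x y z; case: (fracP x) (fracP y) (fracP z) => [a [s ->]] [b [t ->]] [c [r ->]].
by rewrite !(loc_mulE, loc_addE); apply: frac_eq1; rewrite ?(denM, den1); ring.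
Qed.

Lemma loc_1_neq0 : frac 1 denom1 != frac 0 denom1.
Proof.
apply/eqP => /frac_eqP[u]; rewrite den1 mul0r subr0 !mulr1 => u0.
by apply: (denomP (s := u)); rewrite u0; exact: ideal0.
Qed.

HB.instance Definition _ := GRing.Zmodule_isComNzRing.Build localization
  loc_mulA loc_mulC loc_mul1 loc_mulD loc_1_neq0.

End Localization.

Definition regular_local (B : comNzRingType) : Prop :=
  noetherian B /\
  exists m : ideal B,
    [/\ is_maximal m,
        forall m' : ideal B, is_maximal m' -> m' = m &
        exists2 d, krull_dim B d & exists x : 'I_d -> B, m = ideal_span (range x)].

Definition regular_ring (A : comNzRingType) : Prop :=
  noetherian A /\
  forall (P : ideal A) (primeP : is_prime P), regular_local (localization primeP).

(* [I / I^2], whose elements are the cosets [a + I^2], as subsets of [A]. *)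
Record conormal (A : comNzRingType) (I : ideal A) := Conormal {
  coset_set :> set A;
  coset_setP : exists2 a, I a & coset_set = [set a + z | z in ideal_mul I I] }.

Section Conormal.
Context (A : comNzRingType) (I : ideal A).
Local Notation I2 := (ideal_mul I I).
Implicit Types (C D E : conormal I).

HB.instance Definition _ := gen_eqMixin (conormal I).
HB.instance Definition _ := gen_choiceMixin (conormal I).

Lemma ideal_sq_sub : I2 `<=` I.
Proof. by apply: ideal_mul_ind => x y _; exact: idealMl. Qed.

Lemma conormal_eq C D : coset_set C = coset_set D -> C = D.
Proof.
case: C D => [C hC] [D hD] /= e; rewrite -e in hD *; congr Conormal.
exact: Prop_irrelevance.
Qed.

Lemma coset_subI C x : C x -> I x.
Proof.
by have [a ha ->] := coset_setP C => -[z /ideal_sq_sub hz <-]; exact: idealD.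
Qed.

Lemma coset_mem C x y : C x -> C y <-> I2 (y - x).
Proof.
have [a ha ->] := coset_setP C => -[z hz <-]; split.
  by case=> w hw <-; rewrite opprD addrACA subrr add0r; exact: idealB.
move=> h; exists (z + (y - (a + z))); first exact: idealD.
by rewrite addrA addrC subrK.
Qed.

Lemma coset_eq C D x : C x -> D x -> C = D.
Proof.
move=> hC hD; apply/conormal_eq/funext => y; apply/propext.
by rewrite (coset_mem y hC) (coset_mem y hD).
Qed.

Lemma coset_of_subproof a (ha : I a) :
  exists2 b, I b & [set a + z | z in I2] = [set b + z | z in I2].
Proof. by exists a. Qed.

Definition coset_of a (ha : I a) : conormal I := Conormal (coset_of_subproof ha).

Lemma mem_coset_of a (ha : I a) : coset_of ha a.
Proof. by exists 0; [exact: ideal0|rewrite addr0]. Qed.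

Lemma coset_nonempty C : exists x, C x.
Proof.
have [a ha ->] := coset_setP C.
by exists a, 0; [exact: ideal0|rewrite addr0].
Qed.

Definition coset_repr C : A := sval (cid (coset_nonempty C)).

Lemma coset_reprP C : C (coset_repr C).
Proof. exact: (svalP (cid (coset_nonempty C))). Qed.

Definition coset_zero : conormal I := coset_of (ideal0 I).
Definition coset_add C D : conormal I :=
  coset_of (idealD (coset_subI (coset_reprP C)) (coset_subI (coset_reprP D))).
Definition coset_scale (a : A) C : conormal I :=
  coset_of (idealMl a (coset_subI (coset_reprP C))).
Definition coset_opp C : conormal I := coset_scale (-1) C.

Lemma mem_coset_add C D x y : C x -> D y -> coset_add C D (x + y).
Proof.
move=> hx hy; apply/(coset_mem _ (mem_coset_of _)).
have /(coset_mem _ (coset_reprP C)) h1 := hx.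
have /(coset_mem _ (coset_reprP D)) h2 := hy.
by rewrite opprD addrACA; exact: idealD.
Qed.

Lemma mem_coset_scale a C x : C x -> coset_scale a C (a * x).
Proof.
move=> hx; apply/(coset_mem _ (mem_coset_of _)).
by rewrite -mulrBr; apply/idealMl/(coset_mem _ (coset_reprP C)).
Qed.

Lemma coset_addA : associative coset_add.
Proof.
move=> C D E; have [x hx] := coset_nonempty C.
have [[y hy] [z hz]] := (coset_nonempty D, coset_nonempty E).
apply: (@coset_eq _ _ (x + (y + z))); first by do 2?apply: mem_coset_add.
by rewrite addrA; do 2?apply: mem_coset_add.
Qed.

Lemma coset_addC : commutative coset_add.
Proof.
move=> C D; have [[x hx] [y hy]] := (coset_nonempty C, coset_nonempty D).
apply: (@coset_eq _ _ (x + y)); first exact: mem_coset_add.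
by rewrite addrC; exact: mem_coset_add.
Qed.

Lemma coset_add0 : left_id coset_zero coset_add.
Proof.
move=> C; have [x hx] := coset_nonempty C.
apply: (@coset_eq _ _ (0 + x)); last by rewrite add0r.
by apply: mem_coset_add => //; exact: mem_coset_of.
Qed.

Lemma coset_addN : left_inverse coset_zero coset_opp coset_add.
Proof.
move=> C; have [x hx] := coset_nonempty C.
apply: (@coset_eq _ _ (-1 * x + x)).
  by apply: mem_coset_add => //; exact: mem_coset_scale.
by rewrite mulN1r addNr; exact: mem_coset_of.
Qed.

HB.instance Definition _ :=
  GRing.isZmodule.Build (conormal I) coset_addA coset_addC coset_add0 coset_addN.

Lemma coset_scaleA a b C :
  coset_scale a (coset_scale b C) = coset_scale (a * b) C.
Proof.
have [x hx] := coset_nonempty C.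
apply: (@coset_eq _ _ (a * (b * x))); first by do 2?apply: mem_coset_scale.
by rewrite mulrA; exact: mem_coset_scale.
Qed.

Lemma coset_scale1 : left_id 1 coset_scale.
Proof.
move=> C; have [x hx] := coset_nonempty C.
apply: (@coset_eq _ _ (1 * x)); first exact: mem_coset_scale.
by rewrite mul1r.
Qed.

Lemma coset_scaleDr : right_distributive coset_scale +%R.
Proof.
move=> a C D; have [[x hx] [y hy]] := (coset_nonempty C, coset_nonempty D).
apply: (@coset_eq _ _ (a * (x + y))).
  by apply: mem_coset_scale; exact: mem_coset_add.
by rewrite mulrDr; apply: mem_coset_add; exact: mem_coset_scale.
Qed.

Lemma coset_scaleDl C : {morph coset_scale^~ C : a b / a + b}.
Proof.
move=> a b; have [x hx] := coset_nonempty C.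
apply: (@coset_eq _ _ ((a + b) * x)); first exact: mem_coset_scale.
by rewrite mulrDl; apply: mem_coset_add; exact: mem_coset_scale.
Qed.

HB.instance Definition _ := GRing.Zmodule_isLmodule.Build A (conormal I)
  coset_scaleA coset_scale1 coset_scaleDr coset_scaleDl.

Lemma mem_cosetD C D x y : C x -> D y -> (C + D)%R (x + y).
Proof. exact: mem_coset_add. Qed.

Lemma mem_cosetZ a C x : C x -> (a *: C)%R (a * x).
Proof. exact: mem_coset_scale. Qed.

Lemma mem_coset_sum n (C : 'I_n -> conormal I) (x : 'I_n -> A) :
  (forall i, C i (x i)) -> (\sum_i C i)%R (\sum_i x i).
Proof.
move=> h; elim/big_ind2: _ => //; first exact: (mem_coset_of (ideal0 I)).
by move=> *; exact: mem_cosetD.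
Qed.

End Conormal.

Record LO (A : comNzRingType) (n : nat) := MkLO {
  lo_ideal : ideal A;
  lo_map : {linear 'rV[A]_n -> conormal lo_ideal};
  lo_surj : forall c : conormal lo_ideal, exists v, lo_map v = c }.

HB.instance Definition _ A n := gen_eqMixin (LO A n).
HB.instance Definition _ A n := gen_choiceMixin (LO A n).

Section LocalOrientations.
Context (A : comNzRingType) (n : nat).
Implicit Types (I J : ideal A) (L : LO A n).

Lemma lo_eq L L' : lo_ideal L = lo_ideal L' ->
  (forall v, coset_set (lo_map L v) = lo_map L' v) -> L = L'.
Proof.
case: L L' => [I w sw] [J u su] /= e; case: _ / e in u su * => h.
have e : w = u.
  have {h} : w = u :> (_ -> _) by apply/funext => v; exact/conormal_eq/h.
  case: w u {sw su} => [w [[aw] [lw]]] [u [[au] [lu]]] /= e.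
  subst u; rewrite (Prop_irrelevance aw au); congr (GRing.Linear.Pack _).
  by rewrite (Prop_irrelevance lw lu).
by rewrite e in sw *; congr MkLO; exact: Prop_irrelevance.
Qed.

Section FromGenerators.
Context (I : ideal A) (f : 'rV[A]_n) (fI : forall i, I (f 0 i)).
Hypothesis fgen :
  forall x, I x -> exists v : 'rV[A]_n,
    ideal_mul I I (x - \sum_i v 0 i * f 0 i).

Definition gens_map (v : 'rV[A]_n) : conormal I :=
  coset_of (ideal_sum (fun i => idealMl (v 0 i) (fI i))).

Lemma gens_map_linear : linear gens_map.
Proof.
move=> a u v; apply: (coset_eq (mem_coset_of _)).
suff -> : \sum_i (a *: u + v) 0 i * f 0 i =
          a * (\sum_i u 0 i * f 0 i) + \sum_i v 0 i * f 0 i.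
  by apply: mem_cosetD; [apply: mem_cosetZ|]; exact: mem_coset_of.
rewrite mulr_sumr -big_split; apply: eq_bigr => i _.
by rewrite !mxE mulrDl mulrA.
Qed.

HB.instance Definition _ :=
  GRing.isLinear.Build A 'rV[A]_n (conormal I) *:%R gens_map gens_map_linear.

Lemma gens_map_surj (c : conormal I) : exists v, gens_map v = c.
Proof.
have [x hx] := coset_nonempty c.
have [v hv] := fgen (coset_subI hx).
exists v; apply: (@coset_eq _ _ _ _ x) => //.
exact/(coset_mem _ (mem_coset_of _)).
Qed.

Definition lo_of_gens : LO A n := @MkLO A n I gens_map gens_map_surj.

Lemma mem_lo_of_gens v : lo_map lo_of_gens v (\sum_i v 0 i * f 0 i).
Proof. exact: mem_coset_of. Qed.

End FromGenerators.

Lemma lo_gens L : exists f : 'rV[A]_n,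
  [/\ forall i, lo_map L (delta_mx 0 i) (f 0 i),
      forall i, lo_ideal L (f 0 i),
      forall v, lo_map L v (\sum_i v 0 i * f 0 i) &
      forall x, lo_ideal L x -> exists v : 'rV[A]_n,
        ideal_mul (lo_ideal L) (lo_ideal L) (x - \sum_i v 0 i * f 0 i)].
Proof.
pose f := \row_i coset_repr (lo_map L (delta_mx 0 i)).
have fe i : lo_map L (delta_mx 0 i) (f 0 i) by rewrite mxE; exact: coset_reprP.
have fv v : lo_map L v (\sum_i v 0 i * f 0 i).
  rewrite [X in lo_map L X]row_sum_delta linear_sum.
  by apply: mem_coset_sum => i; rewrite linearZ; exact: mem_cosetZ.
exists f; split=> // [i|x hx]; first exact: coset_subI (fe i).
have [v hv] := lo_surj (coset_of hx); exists v.
by apply/(coset_mem _ (fv v)); rewrite hv; exact: mem_coset_of.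
Qed.

(* The canonical maps [IJ/(IJ)^2 -> I/I^2] and [IJ/(IJ)^2 -> J/J^2] send a
   coset to the one that contains it. *)
Definition induces_both (K I L : LO A n) : Prop :=
  lo_ideal L = ideal_mul (lo_ideal K) (lo_ideal I) /\
  forall v, coset_set (lo_map L v) `<=` lo_map K v /\
            coset_set (lo_map L v) `<=` lo_map I v.

Lemma ideal_mulSl I J : ideal_mul I J `<=` I.
Proof. by apply: ideal_mul_ind => x y hx _; exact: idealMr. Qed.

Lemma ideal_mulSr I J : ideal_mul I J `<=` J.
Proof. by apply: ideal_mul_ind => x y _; exact: idealMl. Qed.

Lemma ideal_mul_mono I J I' J' : I `<=` I' -> J `<=` J' ->
  ideal_mul I J `<=` ideal_mul I' J'.
Proof.
move=> hI hJ; apply: ideal_mul_ind => x y hx hy.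
by apply: ideal_mul_in; [exact: hI|exact: hJ].
Qed.

Lemma comaximal_sq I J : comaximal I J ->
  exists a b, [/\ ideal_mul I I a, ideal_mul J J b & a + b = 1].
Proof.
move=> h; have : [set: A] 1 by [].
rewrite -h => -[a ha [b hb ab]].
exists (a * a * (a + 3%:R * b)), (b * b * (b + 3%:R * a)); split.
- by apply: idealMr; exact: ideal_mul_in.
- by apply: idealMr; exact: ideal_mul_in.
- transitivity ((a + b) ^+ 3); first by ring.
  by rewrite ab expr1n.
Qed.

Lemma colon_subproof I x : is_ideal [set y | I (x * y)].
Proof.
split=> [|y z|a y] /=; first by rewrite mulr0; exact: ideal0.
  by rewrite mulrDr; exact: idealD.
by rewrite mulrCA; exact: idealMl.
Qed.

Lemma ideal_mul_sq_sub I J :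
  ideal_mul (ideal_mul I I) (ideal_mul J J) `<=`
  ideal_mul (ideal_mul I J) (ideal_mul I J).
Proof.
pose colon x := Ideal (colon_subproof (ideal_mul (ideal_mul I J) (ideal_mul I J)) x).
have colonE x y : colon x y = ideal_mul (ideal_mul I J) (ideal_mul I J) (x * y).
  by [].
apply: ideal_mul_ind => x y hx hy.
apply: (@ideal_mul_ind _ J J (colon x)) y hy => j j' hj hj'.
rewrite colonE mulrC.
apply: (@ideal_mul_ind _ I I (colon (j * j'))) x hx => i i' hi hi'.
rewrite colonE (_ : j * j' * (i * i') = (i * j) * (i' * j')); last by ring.
by apply: ideal_mul_in; exact: ideal_mul_in.
Qed.

Lemma comaximal_capsq I J x : comaximal I J ->
  ideal_mul I I x -> ideal_mul J J x ->
  ideal_mul (ideal_mul I J) (ideal_mul I J) x.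
Proof.
move=> /comaximal_sq[a [b [ha hb ab]]] hI hJ; apply: ideal_mul_sq_sub.
rewrite -[x]mul1r -ab mulrDl; apply: idealD; first exact: ideal_mul_in.
by rewrite mulrC; exact: ideal_mul_in.
Qed.

Lemma shift_sum x (u v c f : 'rV[A]_n) :
  x - \sum_i u 0 i * c 0 i = (x - \sum_i v 0 i * f 0 i) -
    \sum_i ((u 0 i - v 0 i) * c 0 i + v 0 i * (c 0 i - f 0 i)).
Proof.
rewrite -addrA -opprD -big_split /=; congr (_ - _).
by apply: eq_bigr => i _; ring.
Qed.

Lemma shift_gens y (v c f : 'rV[A]_n) :
  y - \sum_i v 0 i * f 0 i = (y - \sum_i v 0 i * c 0 i) +
    \sum_i v 0 i * (c 0 i - f 0 i).
Proof.
rewrite -addrA; congr (_ + _).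
by rewrite -!sumrN -big_split /=; apply: eq_bigr => i _; ring.
Qed.

Lemma lo_star_exists (K I : LO A n) :
  comaximal (lo_ideal K) (lo_ideal I) -> exists L, induces_both K I L.
Proof.
move=> h; have [a [b [ha hb ab]]] := comaximal_sq h.
have [f [_ fK fv fgen]] := lo_gens K; have [g [_ gI gv ggen]] := lo_gens I.
set KI := ideal_mul (lo_ideal K) (lo_ideal I).
pose c := b *: f + a *: g.
have cE i : c 0 i = b * f 0 i + a * g 0 i by rewrite !mxE.
have cKI i : KI (c 0 i).
  rewrite cE; apply: idealD; last first.
    by apply: ideal_mul_in => //; exact: ideal_sq_sub.
  by rewrite mulrC; apply: ideal_mul_in => //; exact: ideal_sq_sub.
have bE : b = 1 - a by rewrite -ab addrAC subrr add0r.
have aE : a = 1 - b by rewrite -ab addrK.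
have hf i : ideal_mul (lo_ideal K) (lo_ideal K) (c 0 i - f 0 i).
  rewrite cE (_ : _ - _ = (g 0 i - f 0 i) * a); first exact: idealMl.
  by rewrite bE; ring.
have hg i : ideal_mul (lo_ideal I) (lo_ideal I) (c 0 i - g 0 i).
  rewrite cE (_ : _ - _ = (f 0 i - g 0 i) * b); first exact: idealMl.
  by rewrite aE; ring.
have cgen x : KI x -> exists v : 'rV[A]_n,
    ideal_mul KI KI (x - \sum_i v 0 i * c 0 i).
  move=> hx; have [v hv] := fgen x (ideal_mulSl hx).
  have [w hw] := ggen x (ideal_mulSr hx).
  exists (b *: v + a *: w); apply: comaximal_capsq => //.
    rewrite (shift_sum _ _ v _ f); apply: idealB => //.
    apply: ideal_sum => i; apply: idealD; last exact: idealMl.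
    rewrite !mxE bE (_ : _ - _ = (w 0 i - v 0 i) * a); last by ring.
    by apply/idealMr/idealMl.
  rewrite (shift_sum _ _ w _ g); apply: idealB => //.
  apply: ideal_sum => i; apply: idealD; last exact: idealMl.
  rewrite !mxE aE (_ : _ - _ = (v 0 i - w 0 i) * b); last by ring.
  by apply/idealMr/idealMl.
exists (lo_of_gens cKI cgen); split=> // v.
have memL := mem_lo_of_gens cKI cgen v.
split=> y /(coset_mem _ memL) hy.
  apply/(coset_mem _ (fv v)).
  rewrite (shift_gens _ _ c); apply: idealD; last by apply: ideal_sum => i; exact: idealMl.
  by apply: ideal_mul_mono hy; exact: ideal_mulSl.
apply/(coset_mem _ (gv v)).
rewrite (shift_gens _ _ c); apply: idealD; last by apply: ideal_sum => i; exact: idealMl.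
by apply: ideal_mul_mono hy; exact: ideal_mulSr.
Qed.

Definition lo_star (K I : LO A n) (h : comaximal (lo_ideal K) (lo_ideal I)) :
  LO A n := sval (cid (lo_star_exists h)).

Lemma lo_starP (K I : LO A n) (h : comaximal (lo_ideal K) (lo_ideal I)) :
  induces_both K I (lo_star h).
Proof. exact: (svalP (cid (lo_star_exists h))). Qed.

Lemma lo_star_unique (K I L : LO A n)
    (h : comaximal (lo_ideal K) (lo_ideal I)) :
  induces_both K I L -> L = lo_star h.
Proof.
case: L (lo_star h) (lo_starP h) => [M w sw] [N u su] [/= eN hN] [/= eM hM].
subst M N; apply: lo_eq => //= v; congr coset_set.
have [[x hx] [y hy]] := (coset_nonempty (w v), coset_nonempty (u v)).
apply: (coset_eq hx); apply/(coset_mem _ hy); apply: comaximal_capsq => //.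
  by apply/(coset_mem _ ((hN v).1 _ hy)); exact: (hM v).1.
by apply/(coset_mem _ ((hN v).2 _ hy)); exact: (hM v).2.
Qed.

End LocalOrientations.

Section Specialization.
Context (A : comNzRingType) (n : nat) (t : A).

Lemma ideal_eval_subproof (J : ideal {poly A}) :
  is_ideal [set p.[t] | p in J].
Proof.
split=> [|_ _ [p hp <-] [q hq <-]|a _ [p hp <-]].
- by exists 0; [exact: (ideal0 J)|rewrite horner0].
- by exists (p + q); [exact: idealD|rewrite hornerD].
- by exists (a%:P * p); [exact: idealMl|rewrite hornerM hornerC].
Qed.

Definition ideal_eval (J : ideal {poly A}) : ideal A :=
  Ideal (ideal_eval_subproof J).

(* The map [J/J^2 -> J(t)/J(t)^2] sends a coset to its image under [T |-> t],
   and [A[T]^n -> A^n] is onto. *)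
Definition specializes (H : LO {poly A} n) (L : LO A n) : Prop :=
  lo_ideal L = ideal_eval (lo_ideal H) /\
  forall v : 'rV[{poly A}]_n,
    coset_set (lo_map L (map_mx (horner_eval t) v)) =
    [set p.[t] | p in coset_set (lo_map H v)].

Lemma ideal_pre_eval_subproof (I : ideal A) : is_ideal [set p | I p.[t]].
Proof.
split=> [|p q|a p] /=; first by rewrite horner0; exact: ideal0.
  by rewrite hornerD; exact: idealD.
by rewrite hornerM; exact: idealMl.
Qed.

Lemma ideal_eval_mul (J J' : ideal {poly A}) :
  ideal_set (ideal_mul (ideal_eval J) (ideal_eval J')) =
  ideal_set (ideal_eval (ideal_mul J J')).
Proof.
apply/seteqP; split.
  apply: ideal_mul_ind => _ _ [p hp <-] [q hq <-].
  by exists (p * q); [exact: ideal_mul_in|rewrite hornerM].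
set K := ideal_mul (ideal_eval J) _.
move=> _ [p hp <-]; pose K' := Ideal (ideal_pre_eval_subproof K).
apply: (@ideal_mul_ind _ J J' K') p hp => p q hp hq; rewrite /K' /mkset /=.
rewrite hornerM; have := @ideal_mul_in _ (ideal_eval J) (ideal_eval J') p.[t] q.[t].
by apply; [exists p|exists q].
Qed.

Lemma specialize_exists (H : LO {poly A} n) : exists L, specializes H L.
Proof.
have [f [_ fJ fv fgen]] := lo_gens H; set J := lo_ideal H in fJ fgen *.
pose g := map_mx (horner_eval t) f.
have gJ i : ideal_eval J (g 0 i) by exists (f 0 i); rewrite // mxE.
have ev (v : 'rV[{poly A}]_n) : (\sum_i v 0 i * f 0 i).[t] =
    \sum_i map_mx (horner_eval t) v 0 i * g 0 i.
  by rewrite horner_sum; apply: eq_bigr => i _; rewrite hornerM !mxE.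
have ggen x : ideal_eval J x -> exists v : 'rV[A]_n,
    ideal_mul (ideal_eval J) (ideal_eval J) (x - \sum_i v 0 i * g 0 i).
  case=> p hp <-; have [v hv] := fgen p hp.
  exists (map_mx (horner_eval t) v); rewrite -ev -hornerN -hornerD.
  by rewrite ideal_eval_mul; eexists; [exact: hv|].
exists (lo_of_gens gJ ggen); split=> // v.
have memL := mem_lo_of_gens gJ ggen (map_mx (horner_eval t) v).
apply/seteqP; split=> [y /(coset_mem _ memL)|_ [p hp <-]].
  rewrite -ev ideal_eval_mul => -[p hp pE].
  exists (p + \sum_i v 0 i * f 0 i); last by rewrite hornerD pE subrK.
  by apply/(coset_mem _ (fv v)); rewrite addrK.
apply/(coset_mem _ memL); rewrite -ev -hornerN -hornerD ideal_eval_mul.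
by eexists; last reflexivity; apply/(coset_mem _ (fv v)).
Qed.

Definition lo_eval (H : LO {poly A} n) : LO A n :=
  sval (cid (specialize_exists H)).

Lemma lo_evalP H : specializes H (lo_eval H).
Proof. exact: (svalP (cid (specialize_exists H))). Qed.

Lemma lo_eval_unique H L : specializes H L -> L = lo_eval H.
Proof.
move=> [e hL]; have [e' hE] := lo_evalP H; apply: lo_eq; first by rewrite e e'.
move=> v; have vE : map_mx (horner_eval t) (map_mx polyC v) = v.
  by apply/matrixP => i j; rewrite !mxE /horner_eval hornerC.
by rewrite -vE hL hE.
Qed.

End Specialization.

Section GeneratedQuotient.
Context (T : choiceType) (R : T -> T -> Prop).

Definition gen_rel (x y : T) : bool := `[< clos_refl_sym_trans T R x y >].

Lemma gen_rel_refl : reflexive gen_rel.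
Proof. by move=> x; apply/asboolP; exact: rst_refl. Qed.

Lemma gen_rel_sym : symmetric gen_rel.
Proof. by move=> x y; apply/asboolP/asboolP => h; exact: rst_sym. Qed.

Lemma gen_rel_trans : transitive gen_rel.
Proof.
by move=> y x z /asboolP h /asboolP h'; apply/asboolP; exact: rst_trans h h'.
Qed.

Canonical gen_rel_equiv :=
  EquivRel gen_rel gen_rel_refl gen_rel_sym gen_rel_trans.

Definition gen_quot := {eq_quot gen_rel}.
HB.instance Definition _ := Choice.on gen_quot.
HB.instance Definition _ := EqQuotient.on gen_quot.

End GeneratedQuotient.

Definition lo_homotopic (A : comNzRingType) (n : nat) (L0 L1 : LO A n) : Prop :=
  exists H : LO {poly A} n, lo_eval 0 H = L0 /\ lo_eval 1 H = L1.

Definition pi0_LO (A : comNzRingType) (n : nat) :=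
  gen_quot (@lo_homotopic A n).

(* The points [(s; f_1, ..., f_n; g_1, ..., g_n)] of [Q_2n]. *)
Record quadric (A : comNzRingType) (n : nat) := Quadric {
  q_s : A;
  q_f : 'rV[A]_n;
  q_g : 'rV[A]_n;
  q_eq : \sum_(i < n) q_f 0 i * q_g 0 i + q_s * (q_s - 1) = 0 }.

HB.instance Definition _ A n := gen_eqMixin (quadric A n).
HB.instance Definition _ A n := gen_choiceMixin (quadric A n).

Section Quadric.
Context (A : comNzRingType) (n : nat).

Lemma quadric_eval_subproof (t : A) (H : quadric {poly A} n) :
  \sum_(i < n) map_mx (horner_eval t) (q_f H) 0 i *
               map_mx (horner_eval t) (q_g H) 0 i +
    (q_s H).[t] * ((q_s H).[t] - 1) = 0.
Proof.
have := congr1 (horner_eval t) (q_eq H).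
rewrite /horner_eval horner0 hornerD hornerM hornerD hornerN hornerC horner_sum.
move=> e; rewrite -[RHS]e; congr (_ + _).
by apply: eq_bigr => i _; rewrite !mxE hornerM.
Qed.

Definition quadric_eval (t : A) (H : quadric {poly A} n) : quadric A n :=
  Quadric (quadric_eval_subproof t H).

Definition quadric_homotopic (q0 q1 : quadric A n) : Prop :=
  exists H : quadric {poly A} n, quadric_eval 0 H = q0 /\ quadric_eval 1 H = q1.

End Quadric.

Definition pi0_Q (A : comNzRingType) (n : nat) :=
  gen_quot (@quadric_homotopic A n).

Section Zeta.
Context (A : comNzRingType) (n : nat).

Definition zeta_datum (L : LO A n) (q : quadric A n) : Prop :=
  [/\ forall i, lo_ideal L (q_f q 0 i) /\
        coset_set (lo_map L (delta_mx 0 i)) =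
          [set q_f q 0 i + z | z in ideal_mul (lo_ideal L) (lo_ideal L)],
      lo_ideal L (q_s q) &
      lo_ideal L = ideal_span ([set q_f q 0 i | i in [set: 'I_n]] `|` [set q_s q])].

Lemma ideal_span_cons (a : A) (s : seq A) x :
  ideal_span [set` a :: s] x ->
  exists b y, ideal_span [set` s] y /\ x = b * a + y.
Proof.
have hI : is_ideal [set x | exists b y, ideal_span [set` s] y /\ x = b * a + y].
  split=> [|_ _ [b [y [hy ->]]] [c [z [hz ->]]]|c _ [b [y [hy ->]]]].
  - by exists 0, 0; split; [exact: (ideal0 (ideal_span _))|rewrite mul0r addr0].
  - exists (b + c), (y + z); split; first exact: idealD.
    by rewrite mulrDl addrACA.
  - exists (c * b), (c * y); split; first exact: idealMl.
    by rewrite mulrDr mulrA.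
apply: (@ideal_span_sub _ _ (Ideal hI)) => y; rewrite /= inE => /orP[/eqP ->|ys].
  by exists 1, 0; split; [exact: (ideal0 (ideal_span _))|rewrite mul1r addr0].
by exists 0, y; split; [exact: (@sub_ideal_span _ [set` s])|rewrite mul0r add0r].
Qed.

Lemma ideal_span_row (f : 'rV[A]_n) x :
  ideal_span [set f 0 i | i in [set: 'I_n]] x ->
  exists g : 'rV[A]_n, x = \sum_i f 0 i * g 0 i.
Proof.
have hI : is_ideal [set x | exists g : 'rV[A]_n, x = \sum_i f 0 i * g 0 i].
  split=> [|_ _ [g ->] [h ->]|c _ [g ->]].
  - by exists 0; rewrite big1 // => i _; rewrite mxE mulr0.
  - by exists (g + h); rewrite -big_split; apply: eq_bigr => i _; rewrite mxE mulrDr.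
  - by exists (c *: g); rewrite mulr_sumr; apply: eq_bigr => i _; rewrite mxE mulrCA.
apply: (@ideal_span_sub _ _ (Ideal hI)) => _ [i _ <-] /=.
exists (delta_mx 0 i); rewrite (bigD1 i) //= mxE !eqxx mulr1 big1 ?addr0 // => j ji.
by rewrite mxE (negbTE ji) andbF mulr0.
Qed.

(* A determinant-free form of Nakayama's lemma. *)
Lemma nakayama (I N : ideal A) : noetherian A ->
  (forall x, I x -> exists y, N y /\ ideal_mul I I (x - y)) ->
  exists s, I s /\ forall x, I x -> N ((1 - s) * x).
Proof.
move=> /(_ I)[gs Igs] IN.
suff main (ts : seq A) : {subset ts <= gs} -> (exists s, I s /\ forall x, I x ->
      exists y z, [/\ N y, ideal_span [set` ts] z & (1 - s) * x = y + z]) ->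
    exists s, I s /\ forall x, I x -> N ((1 - s) * x).
  apply: (main gs) => //; exists 0; split=> [|x]; first exact: ideal0.
  rewrite subr0 mul1r {1}Igs => hx.
  by exists 0, x; split; [exact: ideal0| |rewrite add0r].
have sub_cons (a : A) us : {subset a :: us <= gs} ->
    I a /\ {subset us <= gs}.
  move=> h; split; first by rewrite Igs; apply: sub_ideal_span; exact/h/mem_head.
  by move=> u hu; apply: h; rewrite inE hu orbT.
have span_sub us : {subset us <= gs} -> ideal_span [set` us] `<=` I.
  move=> h; apply: ideal_span_sub => u hu; rewrite Igs.
  by apply: sub_ideal_span; exact: h.
elim: ts => [|a ts IH] hts [s [Is hs]].
  exists s; split=> // x /hs[y [z [hy hz ->]]]; apply: idealD => //.
  by apply: ideal_span_sub hz => u.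
have [Ia tsgs] := sub_cons _ _ hts; apply: IH => //.
have prod x : ideal_mul I I x -> exists c y z,
    [/\ I c, N y, ideal_span [set` ts] z & (1 - s) * x = c * a + y + z].
  have hJ : is_ideal [set x | exists c y z,
      [/\ I c, N y, ideal_span [set` ts] z & (1 - s) * x = c * a + y + z]].
    split=> [|u v|b u].
    - by exists 0, 0, 0; split; rewrite ?mulr0 ?mul0r ?addr0 //; exact: ideal0.
    - move=> [c [y [z [hc hy hz e]]]] [c' [y' [z' [hc' hy' hz' e']]]].
      exists (c + c'), (y + y'), (z + z'); split; try exact: idealD.
      by rewrite mulrDr e e'; ring.
    - move=> [c [y [z [hc hy hz e]]]].
      exists (b * c), (b * y), (b * z); split; try exact: idealMl.
      by rewrite mulrCA e; ring.
  apply: (@ideal_mul_ind _ I I (Ideal hJ)) => u v hu /hs[y [z [hy hz e]]].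
  have [b [z' [hz' zE]]] := ideal_span_cons hz.
  exists (u * b), (u * y), (u * z'); split; [exact: idealMr|exact: idealMl|exact: idealMl|].
  by rewrite mulrCA e zE; ring.
have [y [hy /prod[c [y' [z' [hc hy' hz' e]]]]]] := IN a Ia.
have ea : (1 - s - c) * a = ((1 - s) * y + y') + z'.
  transitivity ((1 - s) * (a - y) - c * a + (1 - s) * y); first by ring.
  by rewrite e; ring.
exists (1 - (1 - s) * (1 - s - c)); split.
  rewrite (_ : 1 - _ = s * (1 - s - c) + (s + c)); last by ring.
  by apply: idealD; [exact: idealMr|exact: idealD].
move=> x /hs[y1 [z1 [hy1 hz1 e1]]].
have [b [z2 [hz2 z1E]]] := ideal_span_cons hz1.
exists ((1 - s - c) * y1 + b * ((1 - s) * y + y')), (b * z' + (1 - s - c) * z2).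
split.
- apply: idealD; first exact: idealMl.
  by apply/idealMl/idealD => //; exact: idealMl.
- by apply: idealD; exact: idealMl.
- transitivity ((1 - s - c) * ((1 - s) * x)); first by ring.
  rewrite e1 z1E.
  transitivity ((1 - s - c) * y1 + b * ((1 - s - c) * a) + (1 - s - c) * z2).
    by ring.
  by rewrite ea; ring.
Qed.

Lemma zeta_datum_exists (noethA : noetherian A) (L : LO A n) :
  exists q, zeta_datum L q.
Proof.
have [f [fe fI _ fgen]] := lo_gens L; set I := lo_ideal L in fI fgen *.
pose N := ideal_span [set f 0 i | i in [set: 'I_n]].
have [s [Is hs]] : exists s, I s /\ forall x, I x -> N ((1 - s) * x).
  apply: nakayama => // x /fgen[v hv]; exists (\sum_i v 0 i * f 0 i); split=> //.
  apply: ideal_sum => i; apply: idealMl.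
  by apply: sub_ideal_span; exists i.
have /ideal_span_row[g gE] := hs s Is.
have qE : \sum_i f 0 i * g 0 i + s * (s - 1) = 0 by rewrite -gE; ring.
exists (Quadric qE); split=> //= [i|].
  split=> //; apply/seteqP; split=> [y /(coset_mem _ (fe i)) hy|_ [z hz <-]].
    by exists (y - f 0 i) => //; rewrite addrC subrK.
  by apply/(coset_mem _ (fe i)); rewrite addrAC subrr add0r.
apply/ideal_eq/seteqP; split=> [x hx|].
  rewrite (_ : x = (1 - s) * x + x * s); last by ring.
  apply: idealD.
    by apply: ideal_span_sub (hs x hx) => y hy; apply: sub_ideal_span; left.
  by apply: idealMl; apply: sub_ideal_span; right.
by apply: ideal_span_sub => _ [[i _ <-]|->].
Qed.

Definition zeta (noethA : noetherian A) (L : LO A n) : pi0_Q A n :=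
  \pi_(pi0_Q A n) (sval (cid (zeta_datum_exists noethA L))).

Definition zeta_bar (noethA : noetherian A) (x : pi0_LO A n) : pi0_Q A n :=
  zeta noethA (repr x).

End Zeta.

Definition abelian_group_law (T : Type) (add : T -> T -> T) : Prop :=
  [/\ associative add, commutative add &
      exists zero opp, left_id zero add /\ left_inverse zero opp add].

(* Main.v *)
Require Import Defs.
From HB Require Import structures.
From Stdlib Require Import Relations.
From mathcomp Require Import all_boot all_order all_algebra.
From mathcomp Require Import boolp classical_sets.
From mathcomp Require Import ring zify.

(** The inverse of zeta sends (s; f; g) to the ideal (f, s) with e_i |-> f_i.

    To add the class of [I] to that of an ideal [K] of height at least [n], move
    [I] within its homotopy class until it is comaximal to [K]. The result does
    not depend on the move: a homotopy between two points comaximal to [K] can be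
    perturbed, with fixed ends, so that it becomes comaximal to [K[T]], because
    the perturbation imposes [n] generic equations on V(K[T]), whose dimension is
    at most d + 1 - n < n. The product with [K] is then formed over [A[T]].

    The inverse of (s; f; g) is (1 - s; f; g): the product of (f, s) and
    (f, 1 - s) is (f), the class of (0; f; 0), and scaling [f] to 0 connects it
    to (0; e_1; 0), whose ideal is the unit ideal. *)

(* [ring_quotient] shadows [idealMr]. *)
Import Defs.

Set Implicit Arguments.
Unset Strict Implicit.
Unset Printing Implicit Defensive.

Import GRing.Theory.
Local Open Scope ring_scope.
Local Open Scope quotient_scope.

(** The only upper bound at hand is that prime chains of [A] have length at most d, so the dimension
    count on V(K[T]) is done with chains of [A]. A height is bounded below by exhibiting a chain:
    each generic equation yields a strictly smaller prime that still satisfies the earlier ones. For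
    a prime of [A[T]] it is the contraction to [A] whose height is bounded. Two nested primes of
    [A[T]] may have the same contraction, three may not, so the whole count loses a single step: a
    prime over K[T] and n generic equations contracts to height at least 2n - 1, and 2n - 1 > d is
    exactly the hypothesis on n.

    The perturbation must stay on the quadric, so f cannot be changed freely; the change is
    controlled only modulo the primes over the new ideal, which miss 1 - s. A further factor T(1 -
    T) fixes the ends, and primes containing that factor are excluded by comaximality at T = 0 and T
    = 1. *)

(** * Generic elements and lower bounds for heights *)

Section NoetherianRings.
Context (A : comNzRingType).
Implicit Types (I J K P Q : ideal A) (a b c x y : A).
Local Open Scope classical_set_scope.

Lemma sub_ideal_anti I J : I `<=` J -> J `<=` I -> I = J.
Proof. by move=> h h'; apply/ideal_eq/seteqP. Qed.

Lemma ideal_proper_sub I J : I `<=` J -> I <> J -> I `<` J.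
Proof.
by move=> h ne; split=> // h'; apply: ne; exact: sub_ideal_anti.
Qed.

Lemma ideal_span_subP S I : ideal_span S `<=` I <-> S `<=` I.
Proof.
by split=> [h x /sub_ideal_span /h //|]; exact: ideal_span_sub.
Qed.

Lemma ideal_adjoin_subproof I x :
  is_ideal [set y | exists i a, I i /\ y = i + a * x].
Proof.
split=> [|_ _ [i [a [hi ->]]] [j [b [hj ->]]]|b _ [i [a [hi ->]]]].
- by exists 0, 0; split; [exact: ideal0|rewrite mul0r addr0].
- by exists (i + j), (a + b); split; [exact: idealD|ring].
- by exists (b * i), (b * a); split; [exact: idealMl|ring].
Qed.

Definition ideal_adjoin I x : ideal A := Ideal (ideal_adjoin_subproof I x).

Lemma sub_ideal_adjoin I x : I `<=` ideal_adjoin I x.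
Proof. by move=> y hy; exists y, 0; rewrite mul0r addr0. Qed.

Lemma mem_ideal_adjoin I x : ideal_adjoin I x x.
Proof. by exists 0, 1; split; [exact: ideal0|rewrite mul1r add0r]. Qed.

Lemma ideal_adjoin_sub I J x : I `<=` J -> J x -> ideal_adjoin I x `<=` J.
Proof.
by move=> IJ Jx _ [i [a [hi ->]]]; apply: idealD; [exact: IJ|exact: idealMl].
Qed.

Lemma ideal_chain_stationary (I_ : nat -> ideal A) : noetherian A ->
  (forall k, I_ k `<=` I_ k.+1) -> exists k, I_ k.+1 `<=` I_ k.
Proof.
move=> noethA incr.
have mono k m : (k <= m)%N -> I_ k `<=` I_ m.
  elim: m => [|m IH]; first by rewrite leqn0 => /eqP ->.
  by rewrite leq_eqVlt => /orP[/eqP -> //|/IH h]; exact: subset_trans (incr m).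
have hU : is_ideal [set x | exists k, I_ k x].
  split=> [|x y [k hk] [m hm]|a x [k hk]].
  - by exists 0%N; exact: ideal0.
  - exists (maxn k m); apply: idealD.
      by apply: mono hk; exact: leq_maxl.
    by apply: mono hm; exact: leq_maxr.
  - by exists k; exact: idealMl.
have [gs gsE] := noethA (Ideal hU).
have [k hk] : exists k, forall x, x \in gs -> I_ k x.
  have: {subset gs <= gs} by [].
  elim: {1 3}gs => [|x s IH] hs; first by exists 0%N.
  have [y ys|k hk] := IH; first by apply: hs; rewrite inE ys orbT.
  have [m hm] : exists m, I_ m x.
    suff : Ideal hU x by [].
    by rewrite gsE; apply: sub_ideal_span; exact/hs/mem_head.
  exists (maxn k m) => y; rewrite inE => /orP[/eqP ->|/hk hy].
    by apply: mono hm; exact: leq_maxr.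
  by apply: mono hy; exact: leq_maxl.
exists k => x hx; have : Ideal hU x by exists k.+1.
by rewrite gsE; apply: ideal_span_sub.
Qed.

Lemma noetherian_maximal (S : set (ideal A)) I : noetherian A -> S I ->
  exists2 M, S M & I `<=` M /\ forall J, S J -> M `<=` J -> J = M.
Proof.
move=> noethA SI; apply: contrapT => nomax.
pose T := {J : ideal A | S J /\ I `<=` J}.
have next (J : T) : exists J' : T, sval J `<` sval J'.
  case: J => J [SJ IJ] /=; apply: contrapT => h; apply: nomax.
  exists J => //; split=> // J' SJ' JJ'; apply: contrapT => ne.
  have IJ' : I `<=` J' by exact: subset_trans JJ'.
  apply: h; exists (exist _ J' (conj SJ' IJ')).
  by apply: ideal_proper_sub => //= e; exact: ne.
pose T0 : T := exist _ I (conj SI (@subset_refl _ I)).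
have [u uS] := choice next.
have incr k : sval (iter k u T0) `<` sval (iter k.+1 u T0) by exact: uS.
have [k hk] := @ideal_chain_stationary (fun k => sval (iter k u T0)) noethA
  (fun k => (incr k).1).
exact: (incr k).2 hk.
Qed.

Lemma exists_prime J : noetherian A -> ~ J 1 ->
  exists2 P, is_prime P & J `<=` P.
Proof.
move=> noethA J1.
have [M M1 [JM maxM]] := @noetherian_maximal [set I | ~ I 1] J noethA J1.
exists M => //; split=> // x y hxy.
have [|Mx] := pselect (M x); first by left.
right; have [i [a [Mi e]]] : ideal_adjoin M x 1.
  apply: contrapT => h; apply: Mx.
  by rewrite -(maxM _ h (@sub_ideal_adjoin M x)); exact: mem_ideal_adjoin.
have -> : y = i * y + a * (x * y) by rewrite mulrA -mulrDl -e mul1r.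
by apply: idealD; [exact: idealMr|exact: idealMl].
Qed.

HB.instance Definition _ := gen_eqMixin (ideal A).

(** Stands for the set of minimal primes over [J]: each of them occurs in [Ps], possibly beside
    larger primes. *)
Definition covering_primes (Ps : seq (ideal A)) J : Prop :=
  (forall P, P \in Ps -> is_prime P /\ J `<=` P) /\
  (forall P, is_prime P -> J `<=` P -> exists2 P', P' \in Ps & P' `<=` P).

(** Noetherian induction: a counterexample M maximal for inclusion is proper and not prime, so xy is
    in M for some x, y outside it. Every prime over M contains M + (x) or M + (y), and the lists of
    these two ideals are concatenated. *)
Lemma finite_covering_primes J : noetherian A -> exists Ps, covering_primes Ps J.
Proof.
move=> noethA; apply: contrapT => Jbad.
have [M Mbad [_ maxM]] :=
  @noetherian_maximal [set I | ~ exists Ps, covering_primes Ps I] J noethA Jbad.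
have M1 : ~ M 1.
  by move=> h; apply: Mbad; exists [::]; split=> // P [P1 _] /(_ _ h).
have [primeM|] := pselect (is_prime M).
  apply: Mbad; exists [:: M]; split=> [P|P _ MP].
    by rewrite inE => /eqP ->; split.
  by exists M; rewrite ?inE.
move=> /not_andP[//|/existsNP[x /existsNP[y hxy]]].
have {hxy} [Mxy Mx My] : [/\ M (x * y), ~ M x & ~ M y].
  have /not_implyP[h /not_orP[]] := hxy; split=> //.
have good z : ~ M z -> exists Ps, covering_primes Ps (ideal_adjoin M z).
  move=> Mz; apply: contrapT => h; apply: Mz.
  by rewrite -(maxM _ h (@sub_ideal_adjoin M z)); exact: mem_ideal_adjoin.
have [[Ps [Ps1 Ps2]] [Qs [Qs1 Qs2]]] := (good x Mx, good y My).
apply: Mbad; exists (Ps ++ Qs); split=> [P|P primeP MP].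
  rewrite mem_cat => /orP[/Ps1|/Qs1] [primeP h]; split=> //;
    exact: subset_trans (@sub_ideal_adjoin M _) h.
have /primeP.2[Px|Py] := MP _ Mxy.
  have [P' hP' h] := Ps2 P primeP (ideal_adjoin_sub MP Px).
  by exists P'; rewrite // mem_cat hP'.
have [P' hP' h] := Qs2 P primeP (ideal_adjoin_sub MP Py).
by exists P'; rewrite // mem_cat hP' orbT.
Qed.

(** Primes contained in the head P are dropped, since avoiding P avoids them. Induction gives v for
    the rest; if a + cv falls into P, then v is corrected by an element t lying in all the remaining
    primes but not in P. *)
Lemma prime_avoidance (Ps : seq (ideal A)) a c :
  (forall P, P \in Ps -> is_prime P /\ ~ P c) ->
  exists v, forall P, P \in Ps -> ~ P (a + c * v).
Proof.
have [m] := ubnP (size Ps); elim: m Ps => // m IH [|P Ps] szPs hPs.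
  by exists 0.
have [primeP Pc] := hPs P (mem_head _ _).
pose Qs := [seq Q : ideal A <- Ps | ~~ `[< Q `<=` P >]].
have [||v hv] := IH Qs.
- by rewrite size_filter; exact: leq_ltn_trans (count_size _ _) _.
- by move=> Q; rewrite mem_filter => /andP[_ h]; apply: hPs; rewrite inE h orbT.
have [t Qt Pt] : exists2 t, forall Q, Q \in Qs -> Q t & ~ P t.
  have : forall Q, Q \in Qs -> ~ (Q `<=` P).
    by move=> Q; rewrite mem_filter => /andP[/asboolPn].
  elim: Qs {hv} => [|Q Qs IHQ] h; first by exists 1 => //; exact: primeP.1.
  have [R hR|t ht Pt] := IHQ; first by apply: h; rewrite inE hR orbT.
  have /existsNP[u /not_implyP[Qu Pu]] := h Q (mem_head _ _).
  exists (u * t); last by move=> /primeP.2[].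
  move=> R; rewrite inE => /orP[/eqP -> |/ht]; first exact: idealMr.
  exact: idealMl.
have [w Pw hw] : exists2 w, ~ P (a + c * w) & forall Q, Q \in Qs -> ~ Q (a + c * w).
  have [Pv|] := pselect (P (a + c * v)); last by exists v.
  exists (v + t) => [h|Q hQ h].
    have := idealB h Pv; rewrite (_ : _ - _ = c * t); last by ring.
    by move=> /primeP.2[].
  apply: (hv Q hQ); rewrite (_ : _ + _ = a + c * (v + t) - c * t); last by ring.
  by apply: idealB => //; apply: idealMl; exact: Qt.
exists w => Q; rewrite inE => /orP[/eqP -> //|hQ].
have [/asboolP h|h] := boolP `[< Q `<=` P >]; first by move=> /h.
by apply: hw; rewrite mem_filter h.
Qed.

(** The translate avoids those covering primes of each J that miss c. A prime P over J that misses c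
    contains one of them, and cannot equal it when a + cv is in P. *)
Lemma generic_translate (Js : seq (ideal A)) a c : noetherian A ->
  exists v, forall J P, J \in Js -> is_prime P -> J `<=` P -> ~ P c ->
    P (a + c * v) -> exists Q, [/\ is_prime Q, J `<=` Q & Q `<` P].
Proof.
move=> noethA.
have [Ps Ps1 Ps2] : exists2 Ps : seq (ideal A), forall P, P \in Ps -> is_prime P /\ ~ P c &
    forall J P, J \in Js -> is_prime P -> J `<=` P -> ~ P c ->
    exists Q, [/\ Q \in Ps, J `<=` Q & Q `<=` P].
  elim: Js => [|J Js [Ps Ps1 Ps2]]; first by exists [::].
  have [Qs [Qs1 Qs2]] := finite_covering_primes J noethA.
  exists ([seq Q : ideal A <- Qs | ~~ `[< Q c >]] ++ Ps).
    move=> P; rewrite mem_cat mem_filter => /orP[/andP[/asboolPn h /Qs1[? _]] //|].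
    exact: Ps1.
  move=> I P; rewrite inE => /orP[/eqP ->|hI] primeP IP Pc.
    have [Q hQ QP] := Qs2 P primeP IP.
    exists Q; split=> //; last exact: (Qs1 Q hQ).2.
    by rewrite mem_cat mem_filter hQ andbT; apply/orP; left; apply/asboolPn => /QP.
  have [Q [hQ IQ QP]] := Ps2 I P hI primeP IP Pc.
  by exists Q; split=> //; rewrite mem_cat hQ orbT.
have [v hv] := prime_avoidance a Ps1.
exists v => J P hJ primeP JP Pc Pv.
have [Q [hQ JQ QP]] := Ps2 J P hJ primeP JP Pc.
exists Q; split=> //; first exact: (Ps1 Q hQ).1.
by apply: ideal_proper_sub => // e; apply: (hv Q hQ); rewrite e.
Qed.

Lemma comaximalP I J : comaximal I J <-> exists a b, [/\ I a, J b & a + b = 1].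
Proof.
split=> [h|[a [b [Ia Jb ab]]]].
  have : [set: A] 1 by [].
  by rewrite -h => -[a Ia [b Jb e]]; exists a, b.
apply/seteqP; split=> // x _; exists (x * a); first exact: idealMl.
by exists (x * b); [exact: idealMl|rewrite -mulrDr ab mulr1].
Qed.

Lemma comaximal_sym I J : comaximal I J -> comaximal J I.
Proof.
move=> /comaximalP[a [b [Ia Jb ab]]]; apply/comaximalP.
by exists b, a; rewrite addrC.
Qed.

Lemma comaximal_mulr I J K :
  comaximal I J -> comaximal I K -> comaximal I (ideal_mul J K).
Proof.
move=> /comaximalP[a [b [Ia Jb ab]]] /comaximalP[a' [b' [Ia' Kb ab']]].
apply/comaximalP; exists (a + b * a'), (b * b'); split.
- by apply: idealD => //; exact: idealMl.
- exact: ideal_mul_in.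
- by rewrite -addrA -mulrDr ab' mulr1.
Qed.

Lemma comaximal_primes I J : noetherian A ->
  (forall P, is_prime P -> I `<=` P -> J `<=` P -> False) -> comaximal I J.
Proof.
move=> noethA h.
have hS : is_ideal [set z | exists x y, [/\ I x, J y & x + y = z]].
  split=> [|_ _ [x [y [Ix Jy <-]]] [x' [y' [Ix' Jy' <-]]]|c _ [x [y [Ix Jy <-]]]].
  - by exists 0, 0; split; rewrite ?addr0 //; exact: ideal0.
  - by exists (x + x'), (y + y'); split; [exact: idealD|exact: idealD|ring].
  - by exists (c * x), (c * y); split; [exact: idealMl|exact: idealMl|ring].
apply/comaximalP; apply: contrapT => ne.
have [|P primeP SP] := @exists_prime (Ideal hS) noethA.
  by move=> [x [y hxy]]; apply: ne; exists x, y.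
apply: (h P primeP) => x hx; apply: SP.
  by exists x, 0; rewrite addr0; split=> //; exact: ideal0.
by exists 0, x; rewrite add0r; split=> //; exact: ideal0.
Qed.

Lemma prime_mul_sub P I J : is_prime P -> ideal_mul I J `<=` P ->
  I `<=` P \/ J `<=` P.
Proof.
move=> primeP h; have [|/existsNP[x /not_implyP[Ix Px]]] := pselect (I `<=` P).
  by left.
by right=> y Jy; have /h/primeP.2[] := ideal_mul_in Ix Jy.
Qed.

Lemma height_ge_mul I J h :
  height_ge I h -> height_ge J h -> height_ge (ideal_mul I J) h.
Proof.
by move=> hI hJ P primeP /(prime_mul_sub primeP)[]; [exact: hI|exact: hJ].
Qed.

Lemma prime_height_ge0 P : is_prime P -> prime_height_ge P 0.
Proof. by move=> primeP; exists (fun=> P); split=> //; split=> // -[[]] // ? [[]]. Qed.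

Lemma prime_height_geS P Q h : is_prime P -> Q `<` P -> prime_height_ge Q h ->
  prime_height_ge P h.+1.
Proof.
move=> primeP QP [C [[primeC ltC] CQ]].
pose D (i : 'I_h.+2) := if unlift ord_max i is Some j then C j else P.
exists D; split; last by rewrite /D unlift_none.
split=> [i|i j ij]; rewrite /D; first by case: unliftP.
case: unliftP => [i' ei|ei]; case: unliftP => [j' ej|ej].
- by apply: ltC; move: ij; rewrite ei ej !lift_max.
- have le : C i' `<=` C ord_max.
    have [->//|ne] := eqVneq i' ord_max.
    apply: (ltC _ _ _).1; rewrite ltn_neqAle -ltnS ltn_ord andbT.
    by apply: contra ne => /eqP e; apply/eqP/val_inj.
  rewrite CQ in le; split; first exact: subset_trans QP.1.
  by move=> h'; apply: QP.2; exact: subset_trans le.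
- by have := ltn_ord j; rewrite ei in ij; move: ij; rewrite /=; lia.
- by move: ij; rewrite ei ej ltnn.
Qed.

Lemma prime_height_ge_le P h h' : (h' <= h)%N -> prime_height_ge P h ->
  prime_height_ge P h'.
Proof.
move=> le [C [[primeC ltC] CP]].
have lt (i : 'I_h'.+1) : (i + (h - h') < h.+1)%N by have := ltn_ord i; lia.
exists (fun i => C (Ordinal (lt i))); split; last first.
  by rewrite -CP; congr C; apply: val_inj => /=; lia.
by split=> [i|i j ij] //; apply: ltC => /=; lia.
Qed.

Lemma prime_height_ge_dim d P h : krull_dim A d -> prime_height_ge P h -> (h <= d)%N.
Proof. by move=> [_ dimA] [C [chainC _]]; exact: dimA chainC. Qed.

(** Each [v i] is chosen for the ideals spanned by K and the earlier translates, so a prime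
    containing the next translate lies strictly above a prime over such an ideal, and c stays
    outside the smaller prime. One [v] serves all of [Ks] because a single move has to be comaximal
    to several ideals. *)
Lemma generic_translates (Ks : seq (ideal A)) (a : nat -> A) c m :
  noetherian A -> exists v : nat -> A, forall K h P, K \in Ks ->
    height_ge K h -> is_prime P -> K `<=` P -> ~ P c ->
    (forall i, (i < m)%N -> P (a i + c * v i)) -> prime_height_ge P (h + m).
Proof.
move=> noethA; elim: m => [|m [v hv]].
  by exists (fun=> 0) => K h P _ hK primeP KP _ _; rewrite addn0; exact: hK.
pose J K := ideal_span (K `|` [set a i + c * v i | i in [set i | (i < m)%N]]).
have [w hw] := generic_translate [seq J K | K <- Ks] (a m) c noethA.
exists (fun i => if i == m then w else v i) => K h P hK hKh primeP KP Pc Pv.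
have JP : J K `<=` P.
  apply: ideal_span_sub => _ [/KP //|[i /= im <-]].
  by have := Pv i (ltnW im); rewrite (ltn_eqF im).
have := Pv m (ltnSn m); rewrite eqxx => Pw.
have [Q [primeQ /ideal_span_subP JQ QP]] := hw (J K) P (map_f _ hK) primeP JP Pc Pw.
rewrite addnS; apply: (prime_height_geS primeP QP); apply: (hv K) => //.
- by move=> x Kx; apply: JQ; left.
- by move=> /QP.1.
- by move=> i im; apply: JQ; right; exists i.
Qed.

End NoetherianRings.

(* [lia] does not identify sizes that differ by canonical structure paths. *)
Ltac size_lia :=
  repeat match goal with
  | H : is_true (leq _ _) |- _ => revert H
  | H : @eq nat _ _ |- _ => revert H
  end;
  repeat match goal with |- context [@size _ ?s] =>
    let n := fresh in move: (size s) => n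
  end; lia.

(** * Polynomial rings: the basis theorem, contraction and extension of primes *)

Section PolynomialRings.
Context (A : comNzRingType).
Implicit Types (I J K : ideal A) (P Q : ideal {poly A}) (f g h : {poly A}).
Local Open Scope classical_set_scope.

Lemma size_sub_lead f : f != 0 ->
  (size (f - lead_coef f *: 'X^((size f).-1))%R < size f)%N.
Proof.
move=> f0; have sf : (0 < size f)%N by rewrite size_poly_gt0.
rewrite -[X in (_ < X)%N](prednK sf) ltnS; apply/leq_sizeP => j.
rewrite leq_eqVlt coefB coefZ coefXn => /orP[/eqP <-|lt].
  by rewrite eqxx mulr1 lead_coefE subrr.
by rewrite gtn_eqF // mulr0 subr0 nth_default // -(prednK sf).
Qed.

Lemma exists_min_size (S : set {poly A}) f : S f ->
  exists2 g, S g & forall h, S h -> (size g <= size h)%N.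
Proof.
have [m] := ubnP (size f); elim: m f => // m IH f szf Sf.
have [[g [Sg lt]]|h] := pselect (exists g, S g /\ (size g < size f)%N).
  by apply: (IH g) => //; exact: leq_trans lt _.
exists f => // g Sg; rewrite leqNgt; apply/negP => lt; apply: h.
by exists g.
Qed.

(** Euclidean division when [lead_coef g] need not be invertible: each step costs one factor of it.
    The bound on [size q] later places a quotient below a polynomial of minimal size. *)
Lemma pseudo_division f g : g != 0 -> exists k q r,
  [/\ lead_coef g ^+ k *: f = q * g + r, (size r < size g)%N &
      (size q <= (size f).+1 - size g)%N].
Proof.
move=> g0; have [m] := ubnP (size f); elim: m f => // m IH f szf.
have [lt|le] := ltnP (size f) (size g).
  by exists 0%N, 0, f; rewrite expr0 scale1r mul0r add0r size_poly0.
have sg : (0 < size g)%N by rewrite size_poly_gt0.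
have [e eE] : exists e, e = (size f - size g)%N by exists (size f - size g)%N.
have [f' f'E szf'] : exists2 f', lead_coef g *: f = f' + lead_coef f *: ('X^e * g) &
    (size f' < size f)%N.
  exists (lead_coef g *: f - lead_coef f *: ('X^e * g)); first by rewrite subrK.
  rewrite -[X in (_ < X)%N](prednK (leq_trans sg le)) ltnS; apply/leq_sizeP => j.
  rewrite leq_eqVlt coefB !coefZ coefXnM => /orP[/eqP <-|lt].
    rewrite ltnNge (_ : (e <= _)%N) /=; last by size_lia.
    rewrite (_ : (_ - e)%N = (size g).-1); last by size_lia.
    by rewrite -!lead_coefE mulrC subrr.
  rewrite ltnNge (_ : (e <= _)%N) /=; last by size_lia.
  rewrite [f`_j]nth_default ?[g`__]nth_default ?mulr0 ?subr0 //; size_lia.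
have [|k [q [r [E szr szq]]]] := IH f'; first exact: leq_trans szf' szf.
exists k.+1, (q + (lead_coef g ^+ k * lead_coef f) *: 'X^e), r; split=> //.
  by rewrite exprSr -scalerA f'E scalerDr E mulrDl -scalerAl scalerA addrAC.
apply: leq_trans (size_polyD _ _) _; rewrite geq_max; apply/andP; split.
  by apply: leq_trans szq _; size_lia.
by apply: leq_trans (size_scale_leq _ _) _; rewrite size_polyXn; size_lia.
Qed.

(* A sequence of elements of minimal degree outside the span of the previous
   ones is impossible once their leading coefficients stop generating more. *)
Lemma noetherian_poly : noetherian A -> noetherian {poly A}.
Proof.
move=> noethA J; apply: contrapT => nofg.
pose ok (s : seq {poly A}) := (forall f, f \in s -> J f) /\
  (forall f g, f \in s -> J g -> ~ ideal_span [set` s] g -> (size f <= size g)%N).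
pose min (s : seq {poly A}) g := [/\ J g, ~ ideal_span [set` s] g &
  forall h, J h -> ~ ideal_span [set` s] h -> (size g <= size h)%N].
have next (s : seq {poly A}) : ok s -> exists g, min s g.
  move=> [sJ _].
  have [f [Jf sf]] : exists f, J f /\ ~ ideal_span [set` s] f.
    apply: contrapT => h; apply: nofg; exists s; apply: sub_ideal_anti.
      by move=> f Jf; apply: contrapT => h'; apply: h; exists f.
    by apply: ideal_span_sub => f; exact: sJ.
  have [g [Jg sg] gmin] :=
    @exists_min_size [set f | J f /\ ~ ideal_span [set` s] f] f (conj Jf sf).
  by exists g; split=> // h Jh sh; exact: gmin.
have span_cons g (s : seq {poly A}) : ideal_span [set` s] `<=` ideal_span [set` g :: s].
  apply: ideal_span_sub => f fs; apply: sub_ideal_span => /=.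
  by rewrite inE fs orbT.
have okS s g : ok s -> min s g -> ok (g :: s).
  move=> [sJ smin] [Jg sg gmin]; split=> [f|f h].
    by rewrite inE => /orP[/eqP ->|/sJ].
  rewrite inE => /orP[/eqP ->|fs] Jh hs.
    by apply: gmin => // /(@span_cons g).
  by apply: smin => // /(@span_cons g).
pose T := {s | ok s}.
have [u hu] := choice (fun s : T => next (sval s) (svalP s)).
pose step (s : T) : T := exist _ (u s :: sval s) (okS _ _ (svalP s) (hu s)).
have ok0 : ok [::] by [].
pose s_ k := iter k step (exist _ _ ok0 : T).
pose I_ k := ideal_span [set lead_coef f | f in [set` sval (s_ k)]].
have [|k hk] := @ideal_chain_stationary _ I_ noethA.
  move=> k; apply: ideal_span_sub => _ [f fs <-]; apply: sub_ideal_span.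
  by exists f => //=; rewrite inE [_ \in _]fs orbT.
set s := sval (s_ k) in hk; have [_ smin] := svalP (s_ k); rewrite -/s in smin.
have [Jg sg gmin] := hu (s_ k); rewrite -/s in sg gmin; set g := u (s_ k) in Jg sg gmin.
have g0 : g != 0 by apply/eqP => e; apply: sg; rewrite e; exact: ideal0.
(* Taking the coefficient in position [(size g).-1], whether or not it leads, makes this set closed
   under addition. *)
have hL : is_ideal [set a | exists f, [/\ ideal_span [set` s] f,
    (size f <= size g)%N & f`_(size g).-1 = a]].
  split=> [|_ _ [f [sf lef <-]] [h [sh leh <-]]|a _ [f [sf lef <-]]].
  - by exists 0; rewrite size_poly0 coef0; split=> //; exact: ideal0.
  - exists (f + h); rewrite coefD; split=> //; first exact: idealD.
    by rewrite (leq_trans (size_polyD _ _)) // geq_max lef.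
  - exists (a%:P * f); rewrite coefCM; split=> //; first exact: idealMl.
    by rewrite mul_polyC (leq_trans (size_scale_leq _ _)).
have : I_ k (lead_coef g).
  by apply: hk; apply: sub_ideal_span; exists g => //=; exact: mem_head.
move=> /(@ideal_span_sub _ _ (Ideal hL)) -[|f [sf lef fE]].
  move=> _ [f fs <-] /=; exists ('X^(size g - size f) * f); split.
  - by apply: (@idealMl _ (ideal_span [set` s])); exact: sub_ideal_span.
  - apply: leq_trans (size_polyMleq _ _) _; rewrite size_polyXn.
    by have := smin f g fs Jg sg; size_lia.
  - have [->|f0] := eqVneq f 0; first by rewrite mulr0 coef0 lead_coef0.
    have sf : (0 < size f)%N by rewrite size_poly_gt0.
    have le := smin f g fs Jg sg.
    rewrite coefXnM ltnNge (_ : (_ - _ <= _)%N) /=; last by size_lia.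
    by rewrite lead_coefE; congr (_ _ _); size_lia.
have sgt : (0 < size g)%N by rewrite size_poly_gt0.
suff : (size g <= size (g - f)%R)%N.
  rewrite leqNgt => /negP; apply; rewrite -[X in (_ < X)%N](prednK sgt) ltnS.
  apply/leq_sizeP => j; rewrite leq_eqVlt coefB => /orP[/eqP <-|lt].
    by rewrite fE lead_coefE subrr.
  by rewrite !nth_default ?subr0 //; size_lia.
apply: gmin.
  apply: idealB => //; apply: ideal_span_sub sf => x; exact: (svalP (s_ k)).1.
by move=> h; apply: sg; rewrite -[g](subrK f); exact: idealD.
Qed.

Lemma ideal_contract_subproof P : is_ideal [set a : A | P a%:P].
Proof.
split=> [|a b|a b] /=; first exact: ideal0.
  by rewrite polyCD; exact: idealD.
by rewrite polyCM; exact: idealMl.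
Qed.

Definition ideal_contract P : ideal A := Ideal (ideal_contract_subproof P).

Lemma ideal_extend_subproof I : is_ideal [set f : {poly A} | forall i, I f`_i].
Proof.
split=> [i|f g hf hg i|g f hf i] /=; first by rewrite coef0; exact: ideal0.
  by rewrite coefD; exact: idealD.
by rewrite coefM; apply: ideal_sum => j; exact: idealMl.
Qed.

Definition ideal_extend I : ideal {poly A} := Ideal (ideal_extend_subproof I).

Lemma ideal_extendC I a : ideal_extend I a%:P <-> I a.
Proof.
split=> [/(_ 0%N)|Ia i]; rewrite coefC //.
by case: eqP => _ //; exact: ideal0.
Qed.

Lemma ideal_extendS I J : I `<=` J -> ideal_extend I `<=` ideal_extend J.
Proof. by move=> IJ f If i; exact: IJ. Qed.

Lemma ideal_contractS P Q : P `<=` Q -> ideal_contract P `<=` ideal_contract Q.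
Proof. by move=> PQ a /PQ. Qed.

Lemma ideal_extendK I : ideal_contract (ideal_extend I) = I.
Proof.
apply: sub_ideal_anti => a; first by move=> /(@ideal_extendC I a).
by move=> Ia; apply/(@ideal_extendC I a).
Qed.

Lemma ideal_contract_extend_sub P : ideal_extend (ideal_contract P) `<=` P.
Proof.
move=> f hf; rewrite -[f]coefK poly_def; apply: ideal_sum => i.
by rewrite -mul_polyC mulrC; apply: idealMl; exact: hf.
Qed.

Lemma prime_contract P : is_prime P -> is_prime (ideal_contract P).
Proof.
by move=> [P1 primeP]; split=> [//|a b /=]; rewrite polyCM; exact: primeP.
Qed.

(** Stands for (A/I)[T] being a domain: one of the two leading coefficients is in [I], and removing
    that leading term lowers the total size. *)
Lemma prime_extend I : is_prime I -> is_prime (ideal_extend I).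
Proof.
move=> primeI; split=> [/ideal_extendC/primeI.1 //|f g].
have [m] := ubnP (size f + size g); elim: m f g => // m IH f g sz hfg.
have [->|f0] := eqVneq f 0; first by left; exact: ideal0.
have [->|g0] := eqVneq g 0; first by right; exact: ideal0.
have monoI h : I (lead_coef h) -> ideal_extend I (lead_coef h *: 'X^((size h).-1)).
  by move=> Ih; rewrite -mul_polyC; apply: idealMr; apply/ideal_extendC.
have /primeI.2[If|Ig] : I (lead_coef f * lead_coef g).
  by rewrite mul_lead_coef; exact: hfg.
  have := IH (f - lead_coef f *: 'X^((size f).-1)) g.
  case=> [|||]; [by have := size_sub_lead f0; size_lia| | |by right].
    by rewrite mulrBl; apply: idealB => //; apply: idealMr; exact: monoI.
  left; rewrite -[f](subrK (lead_coef f *: 'X^((size f).-1))).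
  by apply: idealD => //; exact: monoI.
have := IH f (g - lead_coef g *: 'X^((size g).-1)).
case=> [|||]; [by have := size_sub_lead g0; size_lia| |by left|].
  by rewrite mulrBr; apply: idealB => //; apply: idealMl; exact: monoI.
right; rewrite -[g](subrK (lead_coef g *: 'X^((size g).-1))).
by apply: idealD => //; exact: monoI.
Qed.

(** Over the residue field of the common contraction p, this says that nonzero primes of a
    polynomial ring in one variable are maximal. The Euclidean argument is run by pseudo-division on
    an f of minimal size in P outside p[T] and a g of minimal size in Q outside P; minimality keeps
    their leading coefficients outside p. *)
Lemma prime_chain_contract P Q : is_prime P -> is_prime Q -> P `<` Q ->
  ideal_contract Q `<=` ideal_contract P -> P `<=` ideal_extend (ideal_contract P).
Proof.
move=> primeP primeQ [PQ nQP] QP; set p := ideal_contract P.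
have primep : is_prime p by exact: prime_contract.
have leadN (S T : ideal {poly A}) f : S f -> ~ T f -> ideal_extend p `<=` S ->
    ideal_extend p `<=` T ->
    (forall h, S h -> ~ T h -> (size f <= size h)%N) -> ~ p (lead_coef f).
  move=> Sf Tf pS pT fmin pf.
  have f0 : f != 0 by apply/eqP => e; apply: Tf; rewrite e; exact: ideal0.
  have hm : ideal_extend p (lead_coef f *: 'X^((size f).-1)).
    by rewrite -mul_polyC; apply: idealMr; apply/ideal_extendC.
  have := size_sub_lead f0; rewrite ltnNge => /negP; apply; apply: fmin.
    by apply: idealB => //; exact: pS.
  by move=> h; apply: Tf; rewrite -[f](subrK (lead_coef f *: 'X^((size f).-1)));
     apply: idealD => //; exact: pT.
have extP : ideal_extend p `<=` P by exact: ideal_contract_extend_sub.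
have powN a k : ~ p a -> ~ p (a ^+ k).
  move=> pa; elim: k => [|k IH]; first exact: primep.1.
  by rewrite exprS => /primep.2[].
apply: contrapT => /existsNP[f0 /not_implyP[Pf0 pf0]].
have [f [Pf pf] fmin] :=
  @exists_min_size [set f | P f /\ ~ ideal_extend p f] f0 (conj Pf0 pf0).
have lf : ~ p (lead_coef f).
  by apply: (leadN P (ideal_extend p)) => // h Ph ph; exact: fmin.
have fn0 : f != 0 by apply/eqP => e; apply: pf; rewrite e; exact: ideal0.
move: nQP => /existsNP[g0 /not_implyP[Qg0 Pg0]].
have [g [Qg Pg] gmin] :=
  @exists_min_size [set g | Q g /\ ~ P g] g0 (conj Qg0 Pg0).
have lg : ~ p (lead_coef g).
  by apply: (leadN Q P) => //; [exact: subset_trans PQ|move=> h Qh Ph; exact: gmin].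
have gn0 : g != 0 by apply/eqP => e; apply: Pg; rewrite e; exact: ideal0.
have Pscale a h : P (a *: h) -> ~ p a -> P h.
  by rewrite -mul_polyC => /primeP.2[].
have [k [q [r [E szr _]]]] := pseudo_division g fn0.
(* The remainder of g by f is in Q but not in P, so it is at least as large as g. *)
have sgf : (size g < size f)%N.
  apply: leq_ltn_trans szr; apply: gmin; split.
    rewrite (_ : r = lead_coef f ^+ k *: g - q * f); last by rewrite E addrAC subrr add0r.
    rewrite -mul_polyC; apply: idealB; first exact: idealMl.
    by apply: idealMl; exact: PQ.
  move=> Pr; apply: Pg; apply: (Pscale (lead_coef f ^+ k)); last exact: powN.
  by rewrite E; apply: idealD => //; exact: idealMl.
have [k' [q' [r' [E' szr' szq']]]] := pseudo_division f gn0.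
have Qr' : Q r'.
  rewrite (_ : r' = lead_coef g ^+ k' *: f - q' * g); last by rewrite E' addrAC subrr add0r.
  by rewrite -mul_polyC; apply: idealB; apply: idealMl => //; exact: PQ.
have Pr' : P r'.
  by apply: contrapT => h; have := gmin r' (conj Qr' h); rewrite leqNgt szr'.
have pr' : ideal_extend p r'.
  apply: contrapT => h; have := fmin r' (conj Pr' h).
  by rewrite leqNgt (ltn_trans szr' sgf).
have Pq' : P q'.
  suff /primeP.2[] : P (q' * g) by [].
  rewrite (_ : _ * _ = lead_coef g ^+ k' *: f - r'); last by rewrite E' addrK.
  by apply: idealB => //; rewrite -mul_polyC; exact: idealMl.
(* A constant in Q lies in the contraction, hence in P. Since [size g] is at least 2, the quotient
   q' is smaller than f, and minimality of f puts it in p[T]. *)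
have sg : (1 < size g)%N.
  rewrite ltnNge; apply/negP => /size1_polyC e; apply: Pg; rewrite e.
  by apply: QP; rewrite /= -e.
have pq' : ideal_extend p q'.
  by apply: contrapT => h; have := fmin q' (conj Pq' h); rewrite leqNgt; size_lia.
have : ideal_extend p ((lead_coef g ^+ k')%:P * f).
  by rewrite mul_polyC E'; apply: idealD => //; exact: idealMr.
move=> /(prime_extend primep).2[/ideal_extendC|//]; exact: powN.
Qed.

(** The content of [P]: the smallest ideal of [A] whose extension contains [P]. *)
Definition coef_ideal P : ideal A :=
  ideal_span [set a | exists2 f, P f & exists i, a = f`_i].

Lemma coef_ideal_extend_sub P : P `<=` ideal_extend (coef_ideal P).
Proof. by move=> f Pf i; apply: sub_ideal_span; exists f => //; exists i. Qed.

Lemma coef_ideal_sub P I : P `<=` ideal_extend I -> coef_ideal P `<=` I.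
Proof. by move=> PI; apply: ideal_span_sub => _ [f /PI h [i ->]]. Qed.

(* A prime that is not extended from [A] contracts to a prime whose height may
   be smaller by one, so the two kinds of primes are tracked separately. *)
Lemma generic_translates_poly K n (a : nat -> {poly A}) (c : {poly A}) m :
  noetherian A -> height_ge K n -> exists v : nat -> {poly A}, forall P,
    is_prime P -> ideal_extend K `<=` P -> ~ P c ->
    (forall i, (i < m)%N -> P (a i + c * v i)) ->
    prime_height_ge (ideal_contract P) (n + m).-1 /\
    (P `<=` ideal_extend (ideal_contract P) ->
     prime_height_ge (ideal_contract P) (n + m)).
Proof.
move=> noethA hK; have noethAX := noetherian_poly noethA.
elim: m => [|m [v hv]].
  exists (fun=> 0) => P primeP KP _ _; rewrite addn0.
  have hP : prime_height_ge (ideal_contract P) n.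
    apply: hK; first exact: prime_contract.
    by move=> x Kx; apply: KP; apply/ideal_extendC.
  by split=> //; apply: prime_height_ge_le hP; exact: leq_pred.
pose J := ideal_span
  (ideal_extend K `|` [set a i + c * v i | i in [set i | (i < m)%N]]).
(* The second ideal serves extended primes: such a prime over [J] contains the extension of the
   content of [J], and a smaller prime over that extension has a contraction whose extension still
   contains [J]. *)
have [w hw] :=
  generic_translate [:: J; ideal_extend (coef_ideal J)] (a m) c noethAX.
exists (fun i => if i == m then w else v i) => P primeP KP Pc Pv.
have JP : J `<=` P.
  apply: ideal_span_sub => _ [/KP //|[i /= im <-]].
  by have := Pv i (ltnW im); rewrite (ltn_eqF im).
have hJ Q : is_prime Q -> J `<=` Q -> ~ Q c ->
    prime_height_ge (ideal_contract Q) (n + m).-1 /\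
    (Q `<=` ideal_extend (ideal_contract Q) ->
     prime_height_ge (ideal_contract Q) (n + m)).
  move=> primeQ /ideal_span_subP JQ Qc; apply: hv => // [x Kx|i im].
    by apply: JQ; left.
  by apply: JQ; right; exists i.
have := Pv m (ltnSn m); rewrite eqxx => Pw.
have primep := prime_contract primeP; rewrite addnS /=; split.
  have [|Q [primeQ JQ QP]] := hw J P _ primeP JP Pc Pw; first by rewrite inE eqxx.
  have [Q1 Q2] := hJ Q primeQ JQ (fun Qc => Pc (QP.1 _ Qc)).
  have qp := ideal_contractS QP.1.
  (* If P and Q have the same contraction, then Q is extended from it, and the stronger bound for Q
     makes up for the missing strict inclusion. *)
  have [pq|npq] := pselect (ideal_contract P `<=` ideal_contract Q).
    rewrite (sub_ideal_anti pq qp).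
    by apply: Q2; exact: prime_chain_contract primeQ primeP QP pq.
  by apply: prime_height_ge_le (prime_height_geS primep (conj qp npq) Q1); size_lia.
move=> Pext; have J'P : ideal_extend (coef_ideal J) `<=` P.
  apply: subset_trans (@ideal_contract_extend_sub P); apply: ideal_extendS.
  by apply: coef_ideal_sub; exact: subset_trans Pext.
have [|Q [primeQ JQ QP]] :=
  hw (ideal_extend (coef_ideal J)) P _ primeP J'P Pc Pw.
  by rewrite !inE eqxx orbT.
set q := ideal_contract Q.
have Jq : J `<=` ideal_extend q.
  apply: subset_trans (@coef_ideal_extend_sub J) _; apply: ideal_extendS.
  by rewrite -(ideal_extendK (coef_ideal J)); exact: ideal_contractS.
have qQ : ideal_extend q `<=` Q by exact: ideal_contract_extend_sub.
have [] := hJ (ideal_extend q) (prime_extend (prime_contract primeQ)) Jq _.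
  by move=> /qQ/QP.1.
rewrite ideal_extendK => _ /(_ (@subset_refl _ _)); apply: prime_height_geS => //.
split; first exact: ideal_contractS QP.1.
move=> pq; apply: QP.2; apply: subset_trans qQ.
by apply: subset_trans Pext _; exact: (@ideal_extendS (ideal_contract P) q pq).
Qed.

End PolynomialRings.

Lemma gen_quotP (T : choiceType) (R : T -> T -> Prop) (x y : T) :
  \pi_(gen_quot R) x = \pi_(gen_quot R) y <-> clos_refl_sym_trans T R x y.
Proof.
by split=> [/eqmodP/asboolP|h] //; apply/eqmodP/asboolP.
Qed.

Lemma gen_quot_ind (T : choiceType) (R : T -> T -> Prop) (U : Type) (F : T -> U) x y :
  (forall x y, R x y -> F x = F y) ->
  \pi_(gen_quot R) x = \pi_(gen_quot R) y -> F x = F y.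
Proof.
move=> hF /gen_quotP; elim=> [u v /hF //|//|u v _ //|u v w _ -> _ //].
Qed.

(** * From points of the quadric back to local orientations *)

Section QuadricsAndLocalOrientations.
Context (A : comNzRingType) (n : nat).
Implicit Types (I J : ideal A) (L : LO A n) (q : quadric A n).
Local Open Scope classical_set_scope.

Definition quadric_ideal q : ideal A :=
  ideal_span ([set q_f q 0 i | i in [set: 'I_n]] `|` [set q_s q]).

Lemma quadric_ideal_f q i : quadric_ideal q (q_f q 0 i).
Proof. by apply: sub_ideal_span; left; exists i. Qed.

Lemma quadric_ideal_s q : quadric_ideal q (q_s q).
Proof. by apply: sub_ideal_span; right. Qed.

Lemma quadric_ideal_sub q I : (forall i, I (q_f q 0 i)) -> I (q_s q) ->
  quadric_ideal q `<=` I.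
Proof. by move=> hf hs; apply: ideal_span_sub => _ [[i _ <-]|->]. Qed.

Lemma q_eq1 q : \sum_i q_f q 0 i * q_g q 0 i = q_s q * (1 - q_s q).
Proof.
by rewrite -[LHS](addrK (q_s q * (q_s q - 1))) q_eq sub0r -mulrN opprB.
Qed.

Lemma sum_delta (f : 'rV[A]_n) i :
  \sum_j (delta_mx 0 i : 'rV[A]_n) 0 j * f 0 j = f 0 i.
Proof.
rewrite (bigD1 i) //= mxE !eqxx mul1r big1 ?addr0 // => j ji.
by rewrite mxE (negbTE ji) andbF mul0r.
Qed.

Lemma quadric_ideal_gen q x : quadric_ideal q x -> exists v : 'rV[A]_n,
  ideal_mul (quadric_ideal q) (quadric_ideal q) (x - \sum_i v 0 i * q_f q 0 i).
Proof.
set I := quadric_ideal q.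
have hS : is_ideal [set x | exists v : 'rV[A]_n,
    ideal_mul I I (x - \sum_i v 0 i * q_f q 0 i)].
  split=> [|y z [v hv] [w hw]|a y [v hv]].
  - exists 0; rewrite big1 ?subr0 //; first exact: ideal0.
    by move=> i _; rewrite mxE mul0r.
  - exists (v + w); rewrite (_ : _ - _ = (y - \sum_i v 0 i * q_f q 0 i) +
      (z - \sum_i w 0 i * q_f q 0 i)); first exact: idealD.
    rewrite addrACA -opprD -big_split /=; congr (_ - _).
    by apply: eq_bigr => i _; rewrite mxE mulrDl.
  - exists (a *: v); rewrite (_ : _ - _ = a * (y - \sum_i v 0 i * q_f q 0 i)).
      exact: idealMl.
    rewrite mulrBr mulr_sumr; congr (_ - _).
    by apply: eq_bigr => i _; rewrite mxE mulrA.
apply: (@quadric_ideal_sub q (Ideal hS)) => /= [i|].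
  by exists (delta_mx 0 i); rewrite sum_delta subrr; exact: (ideal0 (ideal_mul I I)).
(* The equation of the quadric says that s minus the sum of the f_i g_i is s^2. *)
exists (q_g q); rewrite (_ : _ - _ = q_s q * q_s q).
  by apply: (@ideal_mul_in _ I I); exact: quadric_ideal_s.
rewrite (_ : \sum_i _ = q_s q * (1 - q_s q)); first by ring.
by rewrite -q_eq1; apply: eq_bigr => i _; rewrite mulrC.
Qed.

Definition eta q : LO A n :=
  lo_of_gens (@quadric_ideal_f q) (@quadric_ideal_gen q).

(** The ideals are only provably equal, so their cosets are compared as subsets of [A], without a
    transport. *)
Lemma coset_set_eq I J (C : conormal I) (D : conormal J) x :
  I = J -> C x -> D x -> coset_set C = coset_set D.
Proof. by move=> e; subst J => Cx Dx; rewrite (coset_eq Cx Dx). Qed.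

Lemma lo_map_sum L (f v : 'rV[A]_n) :
  (forall i, lo_map L (delta_mx 0 i) (f 0 i)) ->
  lo_map L v (\sum_i v 0 i * f 0 i).
Proof.
move=> hf; rewrite [X in lo_map L X]row_sum_delta linear_sum.
by apply: mem_coset_sum => i; rewrite linearZ; exact: mem_cosetZ.
Qed.

Lemma lo_eq_gens L L' (f : 'rV[A]_n) : lo_ideal L = lo_ideal L' ->
  (forall i, lo_map L (delta_mx 0 i) (f 0 i)) ->
  (forall i, lo_map L' (delta_mx 0 i) (f 0 i)) -> L = L'.
Proof.
move=> e hL hL'; apply: lo_eq => // v.
by apply: (coset_set_eq e (lo_map_sum v hL)); exact: lo_map_sum.
Qed.

Lemma mem_eta q i : lo_map (eta q) (delta_mx 0 i) (q_f q 0 i).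
Proof.
by rewrite -[q_f q 0 i]sum_delta; exact: mem_lo_of_gens.
Qed.

Lemma zeta_datum_mem L q : zeta_datum L q ->
  forall i, lo_map L (delta_mx 0 i) (q_f q 0 i).
Proof.
move=> [h _ _] i; rewrite (h i).2; exists 0; [exact: ideal0|exact: addr0].
Qed.

Lemma zeta_datum_eta L q : zeta_datum L q -> L = eta q.
Proof.
move=> h; apply: (@lo_eq_gens _ _ (q_f q)) => [||i]; last exact: mem_eta.
  by have [_ _ ->] := h.
exact: zeta_datum_mem.
Qed.

Lemma eta_zeta_datum q : zeta_datum (eta q) q.
Proof.
split=> // [i|]; last exact: quadric_ideal_s.
split; first exact: quadric_ideal_f.
apply/seteqP; split=> [y /(coset_mem _ (mem_eta q i)) h|_ [z hz <-]].
  by exists (y - q_f q 0 i) => //; rewrite addrC subrK.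
by apply/(coset_mem _ (mem_eta q i)); rewrite addrAC subrr add0r.
Qed.

Lemma quadric_eq q q' :
  q_s q = q_s q' -> q_f q = q_f q' -> q_g q = q_g q' -> q = q'.
Proof.
case: q q' => [s f g h] [s' f' g' h'] /= es ef eg; subst s' f' g'.
by congr Quadric; exact: Prop_irrelevance.
Qed.

End QuadricsAndLocalOrientations.

(** * Homotopy invariance and bijectivity of zeta *)

Section ZetaBijection.
Context (A : comNzRingType) (n : nat).
Implicit Types (I J : ideal A) (L : LO A n) (q : quadric A n).
Local Open Scope classical_set_scope.

Definition quadric_equiv q q' : Prop :=
  clos_refl_sym_trans (quadric A n) (@quadric_homotopic A n) q q'.

Lemma quadric_homotopic_of (H : quadric {poly A} n) q q' :
  (q_s H).[0] = q_s q -> (q_s H).[1] = q_s q' ->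
  (forall i, (q_f H 0 i).[0] = q_f q 0 i) ->
  (forall i, (q_f H 0 i).[1] = q_f q' 0 i) ->
  (forall i, (q_g H 0 i).[0] = q_g q 0 i) ->
  (forall i, (q_g H 0 i).[1] = q_g q' 0 i) -> quadric_homotopic q q'.
Proof.
by move=> s0 s1 f0 f1 g0 g1; exists H; split; apply: quadric_eq => //=;
  apply/rowP => i; rewrite mxE /horner_eval.
Qed.

(** For fixed s and f the equation is affine in g, so the segment from g to g' stays on the
    quadric. *)
Lemma quadric_homotopic_same_sf q q' :
  q_s q = q_s q' -> q_f q = q_f q' -> quadric_homotopic q q'.
Proof.
move=> es ef; pose g : 'rV[{poly A}]_n :=
  \row_i ((q_g q 0 i)%:P + 'X * (q_g q' 0 i - q_g q 0 i)%:P).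
have H_eq : \sum_(i < n) map_mx polyC (q_f q) 0 i * g 0 i +
    (q_s q)%:P * ((q_s q)%:P - 1) = 0.
  transitivity ((\sum_i q_f q 0 i * q_g q 0 i + q_s q * (q_s q - 1))%:P +
    'X * (\sum_i q_f q' 0 i * q_g q' 0 i - \sum_i q_f q 0 i * q_g q 0 i)%:P).
    rewrite -sumrB polyCD polyCM polyCB polyC1 !raddf_sum /= mulr_sumr.
    rewrite addrAC -big_split /=; congr (_ + _).
    apply: eq_bigr => i _; rewrite !mxE -ef !polyCM polyCB; ring.
  by rewrite q_eq add0r !q_eq1 es subrr mulr0.
apply: (@quadric_homotopic_of (Quadric H_eq)) => /=; rewrite ?hornerC // => i;
  by rewrite !mxE !hornerE ?mul0r ?mul1r ?addr0 ?ef //=; ring.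
Qed.

(* Both [s] and [s'] are idempotent generators of [I / (f)]. *)
Lemma quadric_equiv_same_f q q' : q_f q = q_f q' ->
  quadric_ideal q = quadric_ideal q' -> quadric_equiv q q'.
Proof.
move=> ef eI; pose N := ideal_span [set q_f q 0 i | i in [set: 'I_n]].
have Nf i : N (q_f q 0 i) by apply: sub_ideal_span; exists i.
have idem p x : q_f p = q_f q -> quadric_ideal p x -> N ((1 - q_s p) * x).
  move=> fp; apply: (@quadric_ideal_sub _ _ p (Ideal (colon_subproof N _))) => /= [i|].
    by rewrite fp; exact: (@idealMl _ N).
  by rewrite mulrC -q_eq1 fp; apply: (@ideal_sum _ N) => i; exact: idealMr.
have /ideal_span_row[h hE] : N (q_s q' - q_s q).
  rewrite (_ : _ - _ = (1 - q_s q) * q_s q' - (1 - q_s q') * q_s q); last by ring.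
  apply: idealB; apply: idem => //.
    by rewrite eI; exact: quadric_ideal_s.
  by rewrite -eI; exact: quadric_ideal_s.
pose s : {poly A} := (q_s q)%:P + 'X * (q_s q' - q_s q)%:P.
(* With D = s' - s, the sum of the f_i h_i, one has (s + TD)(1 - s - TD) = s(1 - s) + uD, so adding
   u h to g restores the equation. *)
pose u : {poly A} := 'X * (1 - 2%:R * (q_s q)%:P) - 'X^2 * (q_s q' - q_s q)%:P.
pose g : 'rV[{poly A}]_n := \row_i ((q_g q 0 i)%:P + u * (h 0 i)%:P).
have H_eq : \sum_(i < n) map_mx polyC (q_f q) 0 i * g 0 i + s * (s - 1) = 0.
  rewrite (_ : \sum_i _ = (\sum_i q_f q 0 i * q_g q 0 i)%:P +
    u * (\sum_i q_f q 0 i * h 0 i)%:P).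
    by rewrite -hE q_eq1 /u /s !(polyCM, polyCB); ring.
  rewrite !raddf_sum mulr_sumr -big_split /=.
  by apply: eq_bigr => i _; rewrite !mxE !polyCM; ring.
pose H := Quadric H_eq.
have st : clos_refl_sym_trans _ (@quadric_homotopic A n) (quadric_eval 0 H) (quadric_eval 1 H).
  by apply: rst_step; exists H.
apply: (rst_trans _ _ _ (quadric_eval 0 H));
  last apply: (rst_trans _ _ _ (quadric_eval 1 H)) => //.
  apply: rst_step; apply: quadric_homotopic_same_sf => /=.
    by rewrite /s !hornerE /=; ring.
  by apply/rowP => i; rewrite !mxE /horner_eval hornerC.
apply: rst_step; apply: quadric_homotopic_same_sf => /=.
  by rewrite /s !hornerE /=; ring.
by rewrite -ef; apply/rowP => i; rewrite !mxE /horner_eval hornerC.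
Qed.

Lemma ideal_extend_sub I (J : ideal {poly A}) :
  (forall a, I a -> J a%:P) -> ideal_extend I `<=` J.
Proof.
move=> h f If; rewrite -[f]coefK poly_def; apply: ideal_sum => i.
by rewrite -mul_polyC; apply: idealMr; apply: h; exact: If.
Qed.

(** A criterion for the ideal to stay constant along a homotopy: x is the sum of (1 - s)x, which
    lies in (f), and a multiple of s. *)
Lemma quadric_eval_ideal I (H : quadric {poly A} n) t :
  (forall i, ideal_extend I (q_f H 0 i)) -> ideal_extend I (q_s H) ->
  (forall x, I x -> ideal_span [set q_f H 0 i | i in [set: 'I_n]] ((1 - q_s H) * x%:P)) ->
  quadric_ideal (quadric_eval t H) = I.
Proof.
move=> hf hs hx.
have ev p : ideal_extend I p -> I p.[t].
  apply: (@ideal_extend_sub I (Ideal (ideal_pre_eval_subproof t I))) => a /=.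
  by rewrite hornerC.
apply: sub_ideal_anti.
  by apply: quadric_ideal_sub => [i|] /=; rewrite ?mxE; exact: ev.
move=> x Ix; rewrite (_ : x = ((1 - q_s H) * x%:P).[t] + x * (q_s H).[t]).
  apply: idealD; last by apply: idealMl; exact: (@quadric_ideal_s _ _ (quadric_eval t H)).
  have := hx x Ix; set J := quadric_ideal _.
  apply: (@ideal_span_sub _ _ (Ideal (ideal_pre_eval_subproof t J))) => _ [i _ <-] /=.
  by have := @quadric_ideal_f _ _ (quadric_eval t H) i; rewrite mxE.
by rewrite !hornerE; ring.
Qed.

(** As f and f' agree modulo I^2, the segment between them still generates I[T] modulo its square.
    Nakayama over [A[T]] completes it to a homotopy with constant ideal I, which reduces the claim
    to points with equal f and equal ideal. *)
Lemma zeta_datum_unique L q q' : noetherian A ->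
  zeta_datum L q -> zeta_datum L q' -> quadric_equiv q q'.
Proof.
move=> noethA hq hq'; set I := lo_ideal L.
have [fe fI _ ] := hq; have [fe' _ _] := hq'.
pose f : 'rV[{poly A}]_n :=
  \row_i ((q_f q 0 i)%:P + 'X * (q_f q' 0 i - q_f q 0 i)%:P).
pose IX := ideal_extend I.
have hf i : ideal_mul I I (q_f q' 0 i - q_f q 0 i).
  by apply/(coset_mem _ (zeta_datum_mem hq i)); exact: zeta_datum_mem.
have fIX i : IX (f 0 i).
  rewrite mxE; apply: idealD; first by apply/ideal_extendC; exact: (fe i).1.
  by apply: idealMl; apply/ideal_extendC; exact: ideal_sq_sub.
have sqX a : ideal_mul I I a -> ideal_mul IX IX a%:P.
  apply: (@ideal_mul_ind _ I I (ideal_contract (ideal_mul IX IX))) => x y Ix Iy.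
  rewrite /ideal_contract /= polyCM; apply: (@ideal_mul_in _ IX IX).
    exact/(@ideal_extendC _ I x).
  exact/(@ideal_extendC _ I y).
pose N := ideal_span [set f 0 i | i in [set: 'I_n]].
have Nf i : N (f 0 i) by apply: sub_ideal_span; exists i.
have hS : is_ideal [set x | exists y, N y /\ ideal_mul IX IX (x - y)].
  split=> [|x x' [y [Ny hy]] [y' [Ny' hy']]|a x [y [Ny hy]]].
  - by exists 0; rewrite subr0; split; exact: ideal0.
  - by exists (y + y'); rewrite opprD addrACA; split; exact: idealD.
  - by exists (a * y); rewrite -mulrBr; split; exact: idealMl.
have [|s [IXs hs]] := @nakayama _ IX N (noetherian_poly noethA).
  apply: (@ideal_extend_sub I (Ideal hS)) => a Ia /=.
  have [v hv] : exists v : 'rV[A]_n, ideal_mul I I (a - \sum_i v 0 i * q_f q 0 i).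
    move: Ia; rewrite /I (zeta_datum_eta hq) => Ia; exact: quadric_ideal_gen.
  exists (\sum_i (v 0 i)%:P * f 0 i); split.
    by apply: (@ideal_sum _ N) => i; exact: idealMl.
  rewrite (_ : _ - _ = (a - \sum_i v 0 i * q_f q 0 i)%:P -
      \sum_i (v 0 i)%:P * ('X * (q_f q' 0 i - q_f q 0 i)%:P)).
    apply: (@idealB _ (ideal_mul IX IX)); first exact: sqX.
    by apply: ideal_sum => i; do 2?apply: idealMl; exact: sqX.
  rewrite polyCB [(\sum_i _)%:P]raddf_sum -addrA -opprD -big_split /=; congr (_ - _).
  by apply: eq_bigr => i _; rewrite !mxE polyCM; ring.
have /ideal_span_row[g gE] := hs s IXs.
have H_eq : \sum_(i < n) f 0 i * g 0 i + s * (s - 1) = 0 by rewrite -gE; ring.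
pose H := Quadric H_eq.
have HI t : quadric_ideal (quadric_eval t H) = I.
  by apply: quadric_eval_ideal => // x Ix; apply: hs; apply/ideal_extendC.
apply: (rst_trans _ _ _ (quadric_eval 0 H)).
  apply: quadric_equiv_same_f.
    by apply/rowP => i; rewrite !mxE /horner_eval !hornerE /=; ring.
  by rewrite HI /I; have [_ _ ->] := hq.
apply: (rst_trans _ _ _ (quadric_eval 1 H)); first by apply: rst_step; exists H.
apply: quadric_equiv_same_f.
  by apply/rowP => i; rewrite !mxE /horner_eval !hornerE /=; ring.
by rewrite HI /I; have [_ _ ->] := hq'.
Qed.

Lemma zetaE (noethA : noetherian A) L q : zeta_datum L q ->
  zeta noethA L = \pi_(pi0_Q A n) q.
Proof.
move=> hq; apply/gen_quotP; apply: (@zeta_datum_unique L) => //.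
exact: (svalP (cid (zeta_datum_exists noethA L))).
Qed.

Lemma zeta_eta (noethA : noetherian A) q : zeta noethA (eta q) = \pi_(pi0_Q A n) q.
Proof. by apply: zetaE; exact: eta_zeta_datum. Qed.

Lemma eta_surj L : noetherian A -> exists q, L = eta q.
Proof.
move=> /(@zeta_datum_exists A n)/(_ L)[q hq].
by exists q; exact: zeta_datum_eta.
Qed.

Lemma lo_eval_eta t (H : quadric {poly A} n) :
  forall LH, zeta_datum LH H -> lo_eval t LH = eta (quadric_eval t H).
Proof.
move=> LH hH; have [eI emap] := lo_evalP t LH.
apply: (@lo_eq_gens _ _ _ _ (q_f (quadric_eval t H))) => [||i]; last exact: mem_eta.
  rewrite eI; apply: sub_ideal_anti; last first.
    apply: quadric_ideal_sub => [i|] /=.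
      by exists (q_f H 0 i); [have [/(_ i)[]] := hH|rewrite mxE].
    by exists (q_s H) => //; have [] := hH.
  move=> _ [p hp <-]; move: p hp; have [_ _ ->] := hH.
  pose J := quadric_ideal (quadric_eval t H).
  apply: (@ideal_span_sub _ _ (Ideal (ideal_pre_eval_subproof t J))).
  move=> _ [[i _ <-]|->] /=; last exact: (@quadric_ideal_s _ _ (quadric_eval t H)).
  by have := @quadric_ideal_f _ _ (quadric_eval t H) i; rewrite mxE.
move=> i; have -> : delta_mx 0 i = map_mx (horner_eval t) (delta_mx 0 i) :> 'rV[A]_n.
  by apply/rowP => j; rewrite !mxE /horner_eval; case: (_ && _); rewrite ?hornerC ?horner0.
rewrite emap; exists (q_f H 0 i); first exact: zeta_datum_mem.
by rewrite mxE.
Qed.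

Lemma zeta_homotopic (noethA : noetherian A) L L' :
  lo_homotopic L L' -> zeta noethA L = zeta noethA L'.
Proof.
move=> [H [<- <-]]; have [qH hq] := zeta_datum_exists (noetherian_poly noethA) H.
rewrite !(lo_eval_eta _ hq) !zeta_eta; apply/gen_quotP; apply: rst_step.
by exists qH.
Qed.

Lemma zeta_bar_pi (noethA : noetherian A) L :
  zeta_bar noethA (\pi_(pi0_LO A n) L) = zeta noethA L.
Proof.
rewrite /zeta_bar; apply: (gen_quot_ind (R := @lo_homotopic A n)); last exact: reprK.
exact: zeta_homotopic.
Qed.

Lemma eta_homotopic q q' : quadric_homotopic q q' -> lo_homotopic (eta q) (eta q').
Proof.
move=> [H [<- <-]].
pose LH := lo_of_gens (@quadric_ideal_f _ _ H) (@quadric_ideal_gen _ _ H).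
by exists LH; split; apply: lo_eval_eta; exact: eta_zeta_datum.
Qed.

Lemma zeta_bar_bij (noethA : noetherian A) : bijective (@zeta_bar A n noethA).
Proof.
exists (fun x => \pi_(pi0_LO A n) (eta (repr x))) => x.
  rewrite -[x]reprK zeta_bar_pi; have [q eq] := eta_surj (repr x) noethA.
  rewrite eq zeta_eta; apply: (gen_quot_ind (R := @quadric_homotopic A n)
    (F := fun q => \pi_(pi0_LO A n) (eta q))); last exact: reprK.
  by move=> p p' h; apply/gen_quotP/rst_step; exact: eta_homotopic.
by rewrite zeta_bar_pi zeta_eta reprK.
Qed.

End ZetaBijection.

(** * Algebra of the star product *)

Section Star.
Context (A : comNzRingType) (n : nat).
Implicit Types (I J K : ideal A) (L : LO A n).
Local Open Scope classical_set_scope.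

Lemma ideal_mulC I J : ideal_mul I J = ideal_mul J I.
Proof.
by apply: sub_ideal_anti; apply: ideal_mul_ind => x y Ix Jy; rewrite mulrC;
  exact: ideal_mul_in.
Qed.

Lemma ideal_mulA I J K : ideal_mul (ideal_mul I J) K = ideal_mul I (ideal_mul J K).
Proof.
apply: sub_ideal_anti; apply: ideal_mul_ind => x y.
  move=> IJx Ky; rewrite mulrC; move: x IJx.
  pose C := Ideal (colon_subproof (ideal_mul I (ideal_mul J K)) y).
  apply: (@ideal_mul_ind _ I J C) => u w Iu Jw /=.
  rewrite mulrCA; apply: (@ideal_mul_in _ I (ideal_mul J K)) => //.
  by rewrite mulrC; exact: ideal_mul_in.
move=> Ix; move: y.
pose C := Ideal (colon_subproof (ideal_mul (ideal_mul I J) K) x).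
apply: (@ideal_mul_ind _ J K C) => u w Ju Kw /=.
rewrite mulrA; apply: (@ideal_mul_in _ (ideal_mul I J) K) => //.
exact: ideal_mul_in.
Qed.

Lemma lo_star_ideal (K I : LO A n) (h : comaximal (lo_ideal K) (lo_ideal I)) :
  lo_ideal (lo_star h) = ideal_mul (lo_ideal K) (lo_ideal I).
Proof. exact: (lo_starP h).1. Qed.

(** For comaximal ideals (KI)^2 is the intersection of K^2 and I^2, so the star product takes
    intersections of cosets. Commutativity and associativity then reduce to those of conjunction. *)
Lemma mem_lo_star (K I : LO A n) (h : comaximal (lo_ideal K) (lo_ideal I)) v x :
  lo_map (lo_star h) v x <-> lo_map K v x /\ lo_map I v x.
Proof.
have [e hL] := lo_starP h; split=> [hx|[Kx Ix]].
  by split; [exact: (hL v).1|exact: (hL v).2].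
have [y hy] := coset_nonempty (lo_map (lo_star h) v).
apply/(coset_mem _ hy); rewrite e; apply: comaximal_capsq => //.
  by apply/(coset_mem _ ((hL v).1 _ hy)).
by apply/(coset_mem _ ((hL v).2 _ hy)).
Qed.

Lemma lo_ext L L' : lo_ideal L = lo_ideal L' ->
  (forall v x, lo_map L v x <-> lo_map L' v x) -> L = L'.
Proof.
by move=> e h; apply: lo_eq => // v; apply/seteqP; split=> x /h.
Qed.

Lemma lo_star_congr (K K' I I' : LO A n) (h : comaximal (lo_ideal K) (lo_ideal I))
    (h' : comaximal (lo_ideal K') (lo_ideal I')) :
  K = K' -> I = I' -> lo_star h = lo_star h'.
Proof. by move=> eK eI; subst K' I'; rewrite (Prop_irrelevance h h'). Qed.

Lemma lo_starC (K I : LO A n) (h : comaximal (lo_ideal K) (lo_ideal I))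
    (h' : comaximal (lo_ideal I) (lo_ideal K)) : lo_star h = lo_star h'.
Proof.
apply: lo_ext => [|v x]; first by rewrite !lo_star_ideal ideal_mulC.
by rewrite !mem_lo_star; tauto.
Qed.

Lemma lo_starA (K I J : LO A n) (h : comaximal (lo_ideal K) (lo_ideal I))
    (h' : comaximal (lo_ideal (lo_star h)) (lo_ideal J))
    (g : comaximal (lo_ideal I) (lo_ideal J))
    (g' : comaximal (lo_ideal K) (lo_ideal (lo_star g))) :
  lo_star h' = lo_star g'.
Proof.
apply: lo_ext => [|v x]; first by rewrite !lo_star_ideal ideal_mulA.
by rewrite !mem_lo_star; tauto.
Qed.

End Star.

(** * Specialization commutes with the star product *)

Section SpecializationOfStar.
Context (A : comNzRingType) (n : nat).
Local Open Scope classical_set_scope.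

Lemma comaximal_eval t (K I : LO {poly A} n) :
  comaximal (lo_ideal K) (lo_ideal I) ->
  comaximal (lo_ideal (lo_eval t K)) (lo_ideal (lo_eval t I)).
Proof.
move=> /comaximalP[a [b [Ka Ib ab]]]; apply/comaximalP.
rewrite (lo_evalP t K).1 (lo_evalP t I).1; exists a.[t], b.[t].
by split; [exists a|exists b|rewrite -hornerD ab hornerC].
Qed.

Lemma lo_eval_star t (K I : LO {poly A} n)
    (h : comaximal (lo_ideal K) (lo_ideal I))
    (h' : comaximal (lo_ideal (lo_eval t K)) (lo_ideal (lo_eval t I))) :
  lo_eval t (lo_star h) = lo_star h'.
Proof.
apply: lo_star_unique; have [eS mS] := lo_evalP t (lo_star h).
have [[eK mK] [eI mI]] := (lo_evalP t K, lo_evalP t I); split.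
  by rewrite eS eK eI lo_star_ideal; apply: ideal_eq; rewrite ideal_eval_mul.
move=> v; have -> : v = map_mx (horner_eval t) (map_mx polyC v).
  by apply/matrixP => i j; rewrite !mxE /horner_eval hornerC.
rewrite mS mK mI; split=> _ [p /mem_lo_star[Kp Ip] <-]; by exists p.
Qed.

End SpecializationOfStar.

(** * Moves of a point along the quadric *)

Section Moves.
Context (A : comNzRingType) (n : nat).
Implicit Types (P : ideal A) (q : quadric A n) (u : 'rV[A]_n).
Local Open Scope classical_set_scope.

Definition move_coef q u : A := \sum_i u 0 i * q_g q 0 i.

(** Keep g and let 1 - s' = (1 - s)(1 - m), with m the sum of the u_i g_i. Then s'(1 - s') differs
    from s(1 - s) by a multiple -cm of m, and replacing f by f - cu changes the sum of the f_i g_i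
    by the same amount. *)
Lemma quadric_move_subproof q u (m := move_coef q u) :
  \sum_(i < n) (q_f q - ((1 - q_s q) * (2%:R * q_s q - 1 + (1 - q_s q) * m)) *: u) 0 i
     * q_g q 0 i +
  (q_s q + (1 - q_s q) * m) * (q_s q + (1 - q_s q) * m - 1) = 0.
Proof.
rewrite (_ : \sum_(i < n) _ = \sum_i q_f q 0 i * q_g q 0 i -
  (1 - q_s q) * (2%:R * q_s q - 1 + (1 - q_s q) * m) * m).
  by rewrite q_eq1; ring.
set c := (1 - q_s q) * _.
rewrite [X in _ = _ - _ * X](_ : m = \sum_i u 0 i * q_g q 0 i) //.
rewrite mulr_sumr -sumrB; apply: eq_bigr => i _.
by rewrite !mxE mulrBl mulrA.
Qed.

(* Modulo a prime containing the ideal of the new point, [1 - s] is invertible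
   and [f] is replaced by a unit multiple of [f + (1 - s)^2 u], so that the
   zero locus can be moved by a choice of [u]. *)
Definition quadric_move q u : quadric A n := Quadric (quadric_move_subproof q u).

Lemma quadric_move0 q : quadric_move q 0 = q.
Proof.
have m0 : move_coef q 0 = 0 by apply: big1 => i _; rewrite mxE mul0r.
apply: quadric_eq => //=; first by rewrite m0 mulr0 addr0.
by rewrite scaler0 subr0.
Qed.

(** The new s is 1 - (1 - s)(1 - m), so [P] misses 1 - s. Modulo [P] one has (1 - s)m = -s, which
    turns the coefficient of u in the new f into (1 - s)^2. *)
Lemma quadric_move_prime q u P : is_prime P ->
  quadric_ideal (quadric_move q u) `<=` P ->
  ~ P ((1 - q_s q) ^+ 2) /\ forall i, P (q_f q 0 i + (1 - q_s q) ^+ 2 * u 0 i).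
Proof.
move=> primeP hP; set m := move_coef q u.
have Ps : P (q_s q + (1 - q_s q) * m) by apply: hP; exact: quadric_ideal_s.
have nP : ~ P (1 - q_s q).
  move=> h; apply: primeP.1.
  rewrite (_ : 1 = q_s q + (1 - q_s q) * m + (1 - q_s q) * (1 - m)); last by ring.
  by apply: idealD => //; exact: idealMr.
split=> [|i]; first by rewrite expr2 => /primeP.2[].
have /hP := @quadric_ideal_f _ _ (quadric_move q u) i; rewrite /= !mxE -/m => hi.
rewrite (_ : _ + _ = q_f q 0 i - (1 - q_s q) * (2%:R * q_s q - 1 + (1 - q_s q) * m)
  * u 0 i + (1 - q_s q) * u 0 i * (q_s q + (1 - q_s q) * m)); last by ring.
by apply: idealD => //; exact: idealMl.
Qed.

Lemma quadric_const_subproof q :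
  \sum_(i < n) map_mx polyC (q_f q) 0 i * map_mx polyC (q_g q) 0 i +
    (q_s q)%:P * ((q_s q)%:P - 1) = 0.
Proof.
transitivity (\sum_i q_f q 0 i * q_g q 0 i + q_s q * (q_s q - 1))%:P; last by rewrite q_eq.
rewrite polyCD polyCM polyCB polyC1 [(\sum_i _)%:P]raddf_sum /=.
by congr (_ + _); apply: eq_bigr => i _; rewrite !mxE polyCM.
Qed.

Definition quadric_const q : quadric {poly A} n :=
  Quadric (quadric_const_subproof q).

Lemma quadric_eval_const t q : quadric_eval t (quadric_const q) = q.
Proof.
apply: quadric_eq => /=; rewrite ?hornerC //;
  by apply/rowP => i; rewrite !mxE /horner_eval hornerC.
Qed.

Lemma extend_quadric_ideal q :
  ideal_extend (quadric_ideal q) `<=` quadric_ideal (quadric_const q).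
Proof.
apply: ideal_extend_sub.
apply: (@quadric_ideal_sub _ _ q (ideal_contract (quadric_ideal (quadric_const q)))).
  by move=> i; have := @quadric_ideal_f _ _ (quadric_const q) i; rewrite mxE.
exact: (@quadric_ideal_s _ _ (quadric_const q)).
Qed.

End Moves.

(** * Points and homotopies in general position *)

Section GeneralPosition.
Context (A : comNzRingType) (n : nat).
Implicit Types (I J K : ideal A) (q : quadric A n) (u : 'rV[A]_n).
Local Open Scope classical_set_scope.

Lemma quadric_eval_move t (H : quadric {poly A} n) (v : 'rV[{poly A}]_n) :
  quadric_eval t (quadric_move H v) =
  quadric_move (quadric_eval t H) (map_mx (horner_eval t) v).
Proof.
have mE : (move_coef H v).[t] =
    move_coef (quadric_eval t H) (map_mx (horner_eval t) v).
  by rewrite horner_sum; apply: eq_bigr => i _; rewrite !mxE /horner_eval hornerM.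
apply: quadric_eq => //=; first by rewrite !hornerE mE.
apply/rowP => i; rewrite !mxE /horner_eval -mE.
by rewrite !(hornerD, hornerN, hornerM, hornerC).
Qed.

Lemma quadric_move_homotopic q u : quadric_homotopic q (quadric_move q u).
Proof.
exists (quadric_move (quadric_const q) (\row_i ('X * (u 0 i)%:P))).
split; rewrite quadric_eval_move quadric_eval_const.
  rewrite -[RHS]quadric_move0; congr quadric_move.
  by apply/rowP => i; rewrite !mxE /horner_eval hornerM hornerX mul0r.
congr quadric_move.
by apply/rowP => i; rewrite !mxE /horner_eval hornerM hornerX hornerC mul1r.
Qed.

Context (d : nat) (noethA : noetherian A) (dimA : krull_dim A d).
Context (nd : (d + 2 <= 2 * n)%N).

Lemma quadric_general_position q (Ks : seq (ideal A)) :
  (forall K, K \in Ks -> height_ge K n) ->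
  exists u, height_ge (quadric_ideal (quadric_move q u)) n /\
    forall K, K \in Ks -> comaximal K (quadric_ideal (quadric_move q u)).
Proof.
(* [generic_translates] takes sequences indexed by [nat]; 0 is a filler from position n on. *)
move=> hKs; pose a i := if insub i is Some j then q_f q 0 (j : 'I_n) else 0.
(* The zero ideal, of height at least 0, yields height at least n for the moved ideal. A member of
   [Ks] yields height at least 2n > d for a prime over both ideals, so there is none. *)
pose O : ideal A := ideal_span set0.
have [v hv] := generic_translates (O :: Ks) a ((1 - q_s q) ^+ 2) n noethA.
pose u := \row_(i < n) v i; exists u.
have main K h P : K \in O :: Ks -> height_ge K h -> is_prime P -> K `<=` P ->
    quadric_ideal (quadric_move q u) `<=` P -> prime_height_ge P (h + n).
  move=> KKs Kh primeP KP /(quadric_move_prime primeP)[Ps Pf].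
  apply: (hv K) => // i im; have := Pf (Ordinal im).
  by rewrite /a insubT mxE.
split=> [P primeP|K KKs].
  apply: (main O 0%N) => //; first exact: mem_head.
    by move=> Q primeQ _; exact: prime_height_ge0.
  exact: ideal_span_sub.
apply: comaximal_primes => // P primeP KP qP.
have := main K n P _ (hKs K KKs) primeP KP qP; rewrite inE KKs orbT.
by move=> /(_ isT)/(prime_height_ge_dim dimA); lia.
Qed.

(** Modulo [P] every polynomial equals its value at [t]. *)
Lemma quadric_eval_contract t (H : quadric {poly A} n) (P : ideal {poly A}) :
  quadric_ideal H `<=` P -> P ('X - t%:P) ->
  quadric_ideal (quadric_eval t H) `<=` ideal_contract P.
Proof.
move=> HP Pt; have ev p : P p -> P (p.[t])%:P.
  move=> Pp; have /factor_theorem[r rE] : root (p - (p.[t])%:P) t.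
    by rewrite rootE !hornerE subrr.
  rewrite (_ : _%:P = p - r * ('X - t%:P)); last by rewrite -rE; ring.
  by apply: idealB => //; exact: idealMl.
apply: quadric_ideal_sub => [i|] /=.
  by rewrite mxE; apply: ev; apply: HP; exact: quadric_ideal_f.
by apply: ev; apply: HP; exact: quadric_ideal_s.
Qed.

Lemma quadric_homotopy_general_position (p : quadric A n) (H : quadric {poly A} n)
    (u0 u1 : 'rV[A]_n) :
  height_ge (quadric_ideal p) n ->
  comaximal (quadric_ideal p) (quadric_ideal (quadric_move (quadric_eval 0 H) u0)) ->
  comaximal (quadric_ideal p) (quadric_ideal (quadric_move (quadric_eval 1 H) u1)) ->
  exists G : quadric {poly A} n,
    [/\ quadric_eval 0 G = quadric_move (quadric_eval 0 H) u0,
        quadric_eval 1 G = quadric_move (quadric_eval 1 H) u1 &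
        comaximal (quadric_ideal (quadric_const p)) (quadric_ideal G)].
Proof.
move=> hp h0 h1.
(* T(1 - T) keeps the ends fixed, and (1 - s)^2 is the factor with which a move enters f modulo
   primes. The segment [w] gives the prescribed moves at the ends, whatever [v] is. *)
pose c : {poly A} := 'X * (1 - 'X) * (1 - q_s H) ^+ 2.
pose w i : {poly A} := (u0 0 i)%:P + 'X * (u1 0 i - u0 0 i)%:P.
pose a i := if insub i is Some j then
  q_f H 0 j + (1 - q_s H) ^+ 2 * w (j : 'I_n) else 0.
have [v hv] := generic_translates_poly a c n noethA hp.
pose M := \row_(i < n) (w i + 'X * (1 - 'X) * v i).
pose G := quadric_move H M.
have G0 : quadric_eval 0 G = quadric_move (quadric_eval 0 H) u0.
  rewrite quadric_eval_move; congr quadric_move; apply/rowP => i.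
  by rewrite !mxE /horner_eval /w !(hornerD, hornerM, hornerX, hornerC) !mul0r !addr0.
have G1 : quadric_eval 1 G = quadric_move (quadric_eval 1 H) u1.
  rewrite quadric_eval_move; congr quadric_move; apply/rowP => i.
  rewrite !mxE /horner_eval /w !(hornerD, hornerM, hornerN, hornerX, hornerC).
  by ring.
exists G; split=> //; apply: comaximal_primes => [|P primeP pP GP].
  exact: noetherian_poly.
have extP : ideal_extend (quadric_ideal p) `<=` P.
  exact: subset_trans (@extend_quadric_ideal _ _ p) pP.
(* If P contained T - t, its contraction would be a prime over both comaximal ideals. *)
have noroot t : comaximal (quadric_ideal p) (quadric_ideal (quadric_eval t G)) ->
    ~ P ('X - t%:P).
  move=> /comaximalP[x [y [px Gy xy]]] Pt.
  apply: (prime_contract primeP).1; rewrite -xy; apply: idealD.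
    by apply: extP; apply/ideal_extendC.
  exact: quadric_eval_contract Gy.
have [Ps Pf] := quadric_move_prime primeP GP.
have Pc : ~ P c.
  move=> /primeP.2[/primeP.2[]|//].
    by move=> PX; apply: (noroot 0); [rewrite G0|rewrite subr0].
  move=> PX; apply: (noroot 1); first by rewrite G1.
  by rewrite polyC1 -opprB; exact: idealN.
(* The contraction of P has height at least 2n - 1, which exceeds d. *)
have [|/(prime_height_ge_dim dimA) le _] := hv P primeP extP Pc; last by lia.
move=> i im; have := Pf (Ordinal im); rewrite /a insubT !mxE /=.
by congr (P _); rewrite /c; ring.
Qed.

Lemma zeta_star_homotopic (p q0 q1 : quadric A n) u0 u1
    (h0 : comaximal (lo_ideal (eta p)) (lo_ideal (eta (quadric_move q0 u0))))
    (h1 : comaximal (lo_ideal (eta p)) (lo_ideal (eta (quadric_move q1 u1)))) :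
  height_ge (quadric_ideal p) n -> quadric_homotopic q0 q1 ->
  zeta noethA (lo_star h0) = zeta noethA (lo_star h1).
Proof.
move=> hp [H [E0 E1]]; subst q0 q1.
have [G [G0 G1 pG]] := quadric_homotopy_general_position hp h0 h1.
have h : comaximal (lo_ideal (eta (quadric_const p))) (lo_ideal (eta G)) by [].
have evp t : lo_eval t (eta (quadric_const p)) = eta p.
  by rewrite (lo_eval_eta _ (eta_zeta_datum _)) quadric_eval_const.
have evG t : lo_eval t (eta G) = eta (quadric_eval t G).
  exact: lo_eval_eta (eta_zeta_datum _).
rewrite -(lo_star_congr (comaximal_eval 0 h) h0 (evp 0)); last by rewrite evG G0.
rewrite -(lo_star_congr (comaximal_eval 1 h) h1 (evp 1)); last by rewrite evG G1.
by apply: zeta_homotopic; exists (lo_star h); split; exact: lo_eval_star.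
Qed.

(** The intermediate points of a chain of homotopies need not be comaximal to p. Quantifying over
    moves of both ends lets the middle point of a transitive step be moved into general position; a
    reflexive step compares two moves of one point along its constant homotopy. *)
Lemma zeta_star_equiv (p q0 q1 : quadric A n) u0 u1
    (h0 : comaximal (lo_ideal (eta p)) (lo_ideal (eta (quadric_move q0 u0))))
    (h1 : comaximal (lo_ideal (eta p)) (lo_ideal (eta (quadric_move q1 u1)))) :
  height_ge (quadric_ideal p) n -> quadric_equiv q0 q1 ->
  zeta noethA (lo_star h0) = zeta noethA (lo_star h1).
Proof.
move=> hp E; elim: E u0 u1 h0 h1 => [q q' hqq'|q|q q' _ IH|q q' q'' _ IH _ IH'].
- by move=> u0 u1 h0 h1; exact: zeta_star_homotopic.
- move=> u0 u1 h0 h1; apply: zeta_star_homotopic => //.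
  by exists (quadric_const q); rewrite !quadric_eval_const.
- by move=> u0 u1 h0 h1; rewrite (IH _ _ h1 h0).
- move=> u0 u1 h0 h1.
  have [|u [_ hu]] := @quadric_general_position q' [:: quadric_ideal p].
    by move=> K; rewrite inE => /eqP ->.
  have h : comaximal (lo_ideal (eta p)) (lo_ideal (eta (quadric_move q' u))).
    by apply: hu; exact: mem_head.
  by rewrite (IH _ _ h0 h) (IH' _ _ h h1).
Qed.

End GeneralPosition.

(** * The group law *)

Section Addition.
Context (A : comNzRingType) (n d : nat).
Context (noethA : noetherian A) (dimA : krull_dim A d).
Context (nd : (d + 2 <= 2 * n)%N).
Implicit Types (K I J L : LO A n) (x y z : pi0_Q A n).
Local Open Scope classical_set_scope.
Local Notation zeta := (@zeta A n noethA).

Lemma zeta_star_invariant K I I' (h : comaximal (lo_ideal K) (lo_ideal I))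
    (h' : comaximal (lo_ideal K) (lo_ideal I')) :
  height_ge (lo_ideal K) n -> zeta I = zeta I' ->
  zeta (lo_star h) = zeta (lo_star h').
Proof.
have [p pE] := eta_surj K noethA.
have [[q qE] [q' qE']] := (eta_surj I noethA, eta_surj I' noethA).
subst K I I'; rewrite !zeta_eta => hp /gen_quotP qq'.
have h0 : comaximal (lo_ideal (eta p)) (lo_ideal (eta (quadric_move q 0))).
  by rewrite quadric_move0.
have h1 : comaximal (lo_ideal (eta p)) (lo_ideal (eta (quadric_move q' 0))).
  by rewrite quadric_move0.
rewrite (lo_star_congr h h0) ?quadric_move0 // (lo_star_congr h' h1) ?quadric_move0 //.
exact: (zeta_star_equiv noethA dimA nd).
Qed.

Lemma zeta_general_position x (Ks : seq (ideal A)) :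
  (forall M, M \in Ks -> height_ge M n) ->
  exists I, [/\ x = zeta I, height_ge (lo_ideal I) n &
    forall M, M \in Ks -> comaximal M (lo_ideal I)].
Proof.
move=> hKs; have [u [hu hc]] :=
  quadric_general_position noethA dimA nd (repr x) hKs.
exists (eta (quadric_move (repr x) u)); split=> //.
rewrite zeta_eta -[LHS]reprK; apply/gen_quotP; apply: rst_step.
exact: quadric_move_homotopic.
Qed.

(** Invariance is known in the second factor only, for a first factor of height at least n. Take J
    of height at least n in the class of I, comaximal to K and K': replace I by J, exchange the
    factors, replace K by K', exchange back and replace J by I'. *)
Lemma zeta_star_welldef K I K' I' (h : comaximal (lo_ideal K) (lo_ideal I))
    (h' : comaximal (lo_ideal K') (lo_ideal I')) :
  height_ge (lo_ideal K) n -> height_ge (lo_ideal K') n ->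
  zeta K = zeta K' -> zeta I = zeta I' ->
  zeta (lo_star h) = zeta (lo_star h').
Proof.
move=> hK hK' eK eI.
have [|J [eJ hJ cJ]] := @zeta_general_position (zeta I) [:: lo_ideal K; lo_ideal K'].
  by move=> M; rewrite !inE => /orP[] /eqP ->.
have KJ : comaximal (lo_ideal K) (lo_ideal J) by apply: cJ; rewrite inE eqxx.
have K'J : comaximal (lo_ideal K') (lo_ideal J) by apply: cJ; rewrite !inE eqxx orbT.
rewrite (zeta_star_invariant h KJ hK eJ).
rewrite (zeta_star_invariant h' K'J hK') -?eI //.
rewrite (lo_starC KJ (comaximal_sym KJ)) (lo_starC K'J (comaximal_sym K'J)).
exact: zeta_star_invariant.
Qed.

Lemma zeta_add_exists x y : exists z, forall K I
  (h : comaximal (lo_ideal K) (lo_ideal I)),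
  x = zeta K -> y = zeta I -> height_ge (lo_ideal K) n -> z = zeta (lo_star h).
Proof.
have [//|I [yI hI _]] := @zeta_general_position y [::].
have [|K [xK hK cK]] := @zeta_general_position x [:: lo_ideal I].
  by move=> M; rewrite inE => /eqP ->.
have KI : comaximal (lo_ideal K) (lo_ideal I).
  by apply: comaximal_sym; apply: cK; exact: mem_head.
exists (zeta (lo_star KI)) => K' I' h xK' yI' hK'.
by apply: zeta_star_welldef => //; [rewrite -xK|rewrite -yI].
Qed.

Definition zeta_add x y : pi0_Q A n := sval (cid (zeta_add_exists x y)).

Lemma zeta_addE K I (h : comaximal (lo_ideal K) (lo_ideal I)) :
  height_ge (lo_ideal K) n -> zeta_add (zeta K) (zeta I) = zeta (lo_star h).
Proof.
exact: (svalP (cid (zeta_add_exists (zeta K) (zeta I))) K I h erefl erefl).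
Qed.

Lemma zeta_addC : commutative zeta_add.
Proof.
move=> x y; have [//|I [-> hI _]] := @zeta_general_position y [::].
have [|K [-> hK cK]] := @zeta_general_position x [:: lo_ideal I].
  by move=> M; rewrite inE => /eqP ->.
have IK : comaximal (lo_ideal I) (lo_ideal K) by apply: cK; exact: mem_head.
by rewrite (zeta_addE (comaximal_sym IK)) // (zeta_addE IK) // (lo_starC _ IK).
Qed.

Lemma zeta_addA : associative zeta_add.
Proof.
move=> x y z.
have [//|J [-> hJ _]] := @zeta_general_position z [::].
have [|I [-> hI cI]] := @zeta_general_position y [:: lo_ideal J].
  by move=> M; rewrite inE => /eqP ->.
have [|K [-> hK cK]] := @zeta_general_position x [:: lo_ideal I; lo_ideal J].
  by move=> M; rewrite !inE => /orP[] /eqP ->.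
have IJ : comaximal (lo_ideal I) (lo_ideal J).
  by apply: comaximal_sym; apply: cI; exact: mem_head.
have KI : comaximal (lo_ideal K) (lo_ideal I).
  by apply: comaximal_sym; apply: cK; exact: mem_head.
have KJ : comaximal (lo_ideal K) (lo_ideal J).
  by apply: comaximal_sym; apply: cK; rewrite !inE eqxx orbT.
have K_IJ : comaximal (lo_ideal K) (lo_ideal (lo_star IJ)).
  by rewrite lo_star_ideal; exact: comaximal_mulr.
have KI_J : comaximal (lo_ideal (lo_star KI)) (lo_ideal J).
  by rewrite lo_star_ideal; apply/comaximal_sym/comaximal_mulr; exact: comaximal_sym.
have hKI : height_ge (lo_ideal (lo_star KI)) n.
  by rewrite lo_star_ideal; exact: height_ge_mul.
rewrite (zeta_addE IJ) // (zeta_addE K_IJ) // (zeta_addE KI) // (zeta_addE KI_J) //.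
by rewrite (lo_starA KI_J K_IJ).
Qed.

Context (n_gt0 : (0 < n)%N).

Let i0 : 'I_n := Ordinal n_gt0.

Lemma quadric_of_row_subproof (f : 'rV[A]_n) :
  \sum_(i < n) f 0 i * (0 : 'rV[A]_n) 0 i + 0 * (0 - 1) = 0.
Proof. by rewrite mul0r addr0 big1 // => i _; rewrite mxE mulr0. Qed.

Definition quadric_of_row f : quadric A n := Quadric (quadric_of_row_subproof f).

Lemma quadric_of_row_equiv f f' :
  \pi_(pi0_Q A n) (quadric_of_row f) = \pi_(pi0_Q A n) (quadric_of_row f').
Proof.
suff main g : \pi_(pi0_Q A n) (quadric_of_row 0) = \pi_(pi0_Q A n) (quadric_of_row g).
  by rewrite -!main.
pose F : 'rV[{poly A}]_n := \row_i ('X * (g 0 i)%:P).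
have H_eq : \sum_(i < n) F 0 i * (0 : 'rV[{poly A}]_n) 0 i + 0 * (0 - 1) = 0.
  by rewrite mul0r addr0 big1 // => i _; rewrite [X in _ * X]mxE mulr0.
apply/gen_quotP; apply: rst_step; apply: (@quadric_homotopic_of _ _ (Quadric H_eq)) => /=;
  rewrite ?horner0 // => i;
  by rewrite !mxE ?hornerM ?hornerX ?hornerC ?horner0 ?mul0r ?mul1r.
Qed.

Definition unit_lo : LO A n := eta (quadric_of_row (delta_mx 0 i0)).

Lemma unit_lo1 : lo_ideal unit_lo 1.
Proof.
by have := @quadric_ideal_f _ _ (quadric_of_row (delta_mx 0 i0)) i0; rewrite mxE !eqxx.
Qed.

(** The unit ideal is comaximal to every ideal, its height bound is vacuous and its conormal module
    is zero, so the star product with it changes neither the ideal nor the cosets. *)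
Lemma zeta_add0 : left_id (zeta unit_lo) zeta_add.
Proof.
move=> x; have [//|I [-> hI _]] := @zeta_general_position x [::].
have U a : lo_ideal unit_lo a.
  by rewrite -[a]mulr1; apply: idealMl; exact: unit_lo1.
have h : comaximal (lo_ideal unit_lo) (lo_ideal I).
  by apply/comaximalP; exists 1, 0; rewrite addr0; split=> //; exact: ideal0.
rewrite (zeta_addE h) => [|P [P1 _] /(_ 1)/(_ (U 1))/P1 //].
congr zeta; apply: lo_ext => [|v a].
  rewrite lo_star_ideal; apply: sub_ideal_anti; first exact: ideal_mulSr.
  by move=> a Ia; rewrite -[a]mul1r; exact: ideal_mul_in.
rewrite mem_lo_star; split=> [[]//|Ia]; split=> //.
have [b hb] := coset_nonempty (lo_map unit_lo v).
by apply/(coset_mem _ hb); rewrite -[_ - _]mulr1; exact: ideal_mul_in.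
Qed.

Lemma zeta_opp_exists x : exists y, zeta_add y x = zeta unit_lo.
Proof.
have [//|I [-> hI _]] := @zeta_general_position x [::].
have [q qE] := eta_surj I noethA; subst I.
have q'_eq : \sum_(i < n) q_f q 0 i * q_g q 0 i + (1 - q_s q) * (1 - q_s q - 1) = 0.
  by rewrite q_eq1; ring.
pose q' := Quadric q'_eq; exists (zeta (eta q')); rewrite zeta_addC.
have h : comaximal (lo_ideal (eta q)) (lo_ideal (eta q')).
  apply/comaximalP; exists (q_s q), (1 - q_s q); split; last by ring.
    exact: quadric_ideal_s.
  exact: (@quadric_ideal_s _ _ q').
rewrite (zeta_addE h) // /unit_lo zeta_eta (quadric_of_row_equiv _ (q_f q)).
rewrite -(zeta_eta noethA); congr zeta.
pose N := quadric_ideal (quadric_of_row (q_f q)).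
have Nf i : N (q_f q 0 i) by exact: (@quadric_ideal_f _ _ (quadric_of_row (q_f q))).
apply: (@lo_eq_gens _ _ _ _ (q_f q)) => [|i|i].
- rewrite lo_star_ideal; apply: sub_ideal_anti.
    (* Among the products of generators only s(1 - s) is not visibly in (f), and it is the sum of
       the f_i g_i. *)
    apply: ideal_mul_ind => a b qa q'b.
    rewrite mulrC; move: a qa.
    apply: (@quadric_ideal_sub _ _ q (Ideal (colon_subproof N b))) => /= [i|].
      exact: (@idealMl _ N).
    rewrite mulrC; move: b q'b.
    apply: (@quadric_ideal_sub _ _ q' (Ideal (colon_subproof N (q_s q)))) => /= [i|].
      exact: (@idealMl _ N).
    by rewrite -q_eq1; apply: (@ideal_sum _ N) => i; exact: idealMr.
  apply: quadric_ideal_sub => [i|]; last exact: ideal0.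
  rewrite -[q_f _ 0 i]/(q_f q 0 i).
  rewrite (_ : q_f q 0 i = q_s q * q_f q 0 i + q_f q 0 i * (1 - q_s q)); last by ring.
  apply: idealD; apply: ideal_mul_in.
  + exact: quadric_ideal_s.
  + exact: (@quadric_ideal_f _ _ q' i).
  + exact: quadric_ideal_f.
  + exact: (@quadric_ideal_s _ _ q').
- by apply/mem_lo_star; split; [exact: mem_eta|exact: (mem_eta q')].
- exact: (mem_eta (quadric_of_row (q_f q))).
Qed.

Lemma zeta_add_group : abelian_group_law zeta_add.
Proof.
split; [exact: zeta_addA|exact: zeta_addC|].
have [opp oppE] := choice zeta_opp_exists.
by exists (zeta unit_lo), opp; split; [exact: zeta_add0|move=> x; exact: oppE].
Qed.

End Addition.

Lemma abelian_group_law_transfer (T U : Type) (f : T -> U) (g : U -> T)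
    (add : U -> U -> U) : cancel f g -> cancel g f -> abelian_group_law add ->
  abelian_group_law (fun x y => g (add (f x) (f y))).
Proof.
move=> fK gK [addA addC [zero [opp [add0 addN]]]]; split.
- by move=> x y z; rewrite !gK addA.
- by move=> x y; rewrite addC.
- exists (g zero), (fun x => g (opp (f x))).
  by split=> x; rewrite !gK ?add0 ?addN ?fK.
Qed.

Theorem theorem1p3 (A : comNzRingType) (noethA : noetherian A)
    (regA : regular_ring A)
    (k : fieldType) (iota : {rmorphism k -> A})
    (half : (2%:R : k) \is a GRing.unit)
    (d : nat) (dimA : krull_dim A d)
    (n : nat) (n_ge2 : (2 <= n)%N) (nd : (d + 2 <= 2 * n)%N) :
  [/\ forall L : LO A n, zeta_bar noethA (\pi_(pi0_LO A n) L) = zeta noethA L,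
      bijective (@zeta_bar A n noethA) &
      exists! add : pi0_Q A n -> pi0_Q A n -> pi0_Q A n,
        [/\ abelian_group_law add,
            exists addL : pi0_LO A n -> pi0_LO A n -> pi0_LO A n,
              abelian_group_law addL /\
              {morph @zeta_bar A n noethA : x y / addL x y >-> add x y} &
            forall (x y : pi0_Q A n) (K I : LO A n)
              (KI : comaximal (lo_ideal K) (lo_ideal I)),
              x = zeta noethA K -> y = zeta noethA I ->
              height_ge (lo_ideal K) n ->
              add x y = zeta noethA (lo_star KI)]].
Proof.
have n_gt0 : (0 < n)%N by exact: leq_trans n_ge2.
split; [exact: zeta_bar_pi|exact: zeta_bar_bij|].
have group := zeta_add_group noethA dimA nd n_gt0.
exists (zeta_add noethA dimA nd); split.
  split=> //; last by move=> x y K I KI -> -> hK; exact: zeta_addE.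
  have [g fK gK] := zeta_bar_bij n noethA.
  exists (fun x y => g (zeta_add noethA dimA nd (zeta_bar noethA x) (zeta_bar noethA y))).
  by split; [exact: abelian_group_law_transfer|move=> x y; rewrite gK].
(* Any two classes have representatives to which the formula applies, so the formula determines the
   addition. *)
move=> add [_ _ addE]; apply/funext => x; apply/funext => y.
have [//|I [-> hI _]] := zeta_general_position noethA dimA nd y (Ks := [::]).
have [|K [-> hK cK]] := zeta_general_position noethA dimA nd x (Ks := [:: lo_ideal I]).
  by move=> M; rewrite inE => /eqP ->.
have KI : comaximal (lo_ideal K) (lo_ideal I).
  by apply: comaximal_sym; apply: cK; exact: mem_head.
by rewrite (zeta_addE _ _ _ KI) // (addE _ _ K I KI).
Qed.
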